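(* Let $p$ be a prime and $n,m\in\mathbb{N}$. Let $\boldsymbol\tau=(\tau_1,\dots,\tau_n)\in\mathbb{R}_+^n$ satisfy $\sum_{i=1}^n\tau_i>m+n$ and $\tau_i>1$ for each $i$. Let $\Psi(\mathbf a)=(\|\mathbf a\|^{-\tau_1},\dots,\|\mathbf a\|^{-\tau_n})$, where $\|\mathbf a\|=\max_{1\le i\le m+n}|a_i|$ for $\mathbf a\in\mathbb{Z}^{m+n}$. Then $$\dim_H W^{\mathbb{Z}_p}_{n,m}(\Psi)=\min_{1\le j\le n}\left\{n(m-1)+\frac{n+m-\sum_{i:\tau_i<\tau_j}(\tau_i-\tau_j)}{\tau_j}\right\}=:s,$$ and $\mathcal{H}^s\left(W^{\mathbb{Z}_p}_{n,m}(\Psi)\right)=\infty$.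
   Context: $|\cdot|_p$ is the $p$-adic absolute value, $\mathbb{Z}_p=\{x\in\mathbb{Q}_p:|x|_p\le1\}$, and $\mathbb{Z}_p^{m\times n}$ is the set of $m\times n$ matrices over $\mathbb{Z}_p$, with metric induced by the maximum over entries of $|\cdot|_p$; $X_i$ is the $i$-th column of $X$. The set is $$W^{\mathbb{Z}_p}_{n,m}(\Psi)=\left\{X\in\mathbb{Z}_p^{m\times n}: |\mathbf a_0X_i-a_i|_p<\|\mathbf a\|^{-\tau_i}\ (1\le i\le n)\ \text{for infinitely many } \mathbf a=(\mathbf a_0,a_1,\dots,a_n)\in\mathbb{Z}^{m+n}\right\},$$ where $\mathbf a_0\in\mathbb{Z}^m$ is the row vector of the first $m$ coordinates. $\dim_H$ is Hausdorff dimension and $\mathcal{H}^s$ is $s$-dimensional Hausdorff measure. *)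

(* Defs.v *)
From HB Require Import structures.
From mathcomp Require Import all_boot all_order all_algebra ring_quotient.
From mathcomp Require Import all_classical all_reals all_analysis.
From mathcomp Require Import ring zify.

Set Implicit Arguments.
Unset Strict Implicit.
Unset Printing Implicit Defensive.

Import Order.TTheory GRing.Theory Num.Theory.
Import numFieldNormedType.Exports.

Local Open Scope classical_set_scope.
Local Open Scope ring_scope.

(* If [p] is not prime then [logn p] vanishes and this is the trivial absolute
   value, so that the constructions below do not need a primality proof. *)
Definition padic_absq (p : nat) (q : rat) : rat :=
  if q == 0 then 0
  else p%:R ^ ((logn p `|denq q|)%:Z - (logn p `|numq q|)%:Z).

Section PadicAbsq.
Variable p : nat.
Local Notation nrm := (padic_absq p).

Lemma padic_absq0 : nrm 0 = 0. Proof. by rewrite /padic_absq eqxx. Qed.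

Let p_exp (k : int) : 0 < (if prime p then p%:R else 1) ^ k :> rat.
Proof. by apply: exprz_gt0; case: ifP => // /prime_gt0; rewrite ltr0n. Qed.

Lemma padic_absq_frac (a b : int) : a != 0 -> b != 0 ->
  nrm (a%:~R / b%:~R) =
  (if prime p then p%:R else 1) ^ ((logn p `|b|)%:Z - (logn p `|a|)%:Z).
Proof.
move=> a0 b0; set q := a%:~R / b%:~R.
have q0 : q != 0 by rewrite mulf_neq0 ?invr_eq0 ?intr_eq0.
have E : (numq q * b = a * denq q)%R.
  apply/eqP; rewrite -(eqr_int rat) !rmorphM /=; apply/eqP.
  have := divq_num_den q; rewrite {3}/q => /eqP.
  by rewrite eqr_div ?intr_eq0 ?denq_neq0 // => /eqP.
have /(congr1 (logn p)) : (`|numq q| * `|b| = `|a| * `|denq q|)%N.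
  by rewrite -!abszM E.
rewrite !lognM ?absz_gt0 ?numq_eq0 ?denq_neq0 // => H.
rewrite /padic_absq (negPf q0).
have -> : (logn p `|denq q|)%:Z - (logn p `|numq q|)%:Z
        = (logn p `|b|)%:Z - (logn p `|a|)%:Z by lia.
case: (boolP (prime p)) => // pp.
have l0 k : logn p k = 0%N by rewrite lognE (negPf pp).
by rewrite !l0 subrr !expr0z.
Qed.

Lemma padic_absq_gt0 q : q != 0 -> 0 < nrm q.
Proof.
move=> q0; rewrite -[q]divq_num_den.
by rewrite padic_absq_frac ?numq_eq0 ?denq_neq0.
Qed.

Lemma padic_absq_ge0 q : 0 <= nrm q.
Proof.
by have [->|/padic_absq_gt0/ltW//] := eqVneq q 0; rewrite padic_absq0.
Qed.

Lemma padic_absqM q r : nrm (q * r) = nrm q * nrm r.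
Proof.
have [->|q0] := eqVneq q 0; first by rewrite mul0r padic_absq0 mul0r.
have [->|r0] := eqVneq r 0; first by rewrite mulr0 padic_absq0 mulr0.
rewrite -[q]divq_num_den -[r]divq_num_den mulf_div -!intrM.
rewrite !padic_absq_frac ?mulf_neq0 ?numq_eq0 ?denq_neq0 //.
rewrite !abszM !lognM ?absz_gt0 ?numq_eq0 ?denq_neq0 //.
rewrite -expfzDr; last first.
  by case: ifP => // /prime_gt0; rewrite pnatr_eq0 lt0n.
by congr (_ ^ _); lia.
Qed.

Lemma padic_absq1 : nrm 1 = 1.
Proof. by rewrite /padic_absq /= !logn1 subrr expr0z. Qed.

Lemma padic_absqN q : nrm (- q) = nrm q.
Proof.
have [->|q0] := eqVneq q 0; first by rewrite oppr0.
rewrite -[q]divq_num_den -mulNr -mulrNz.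
by rewrite !padic_absq_frac ?oppr_eq0 ?numq_eq0 ?denq_neq0 // abszN.
Qed.

Lemma padic_absqD q r : nrm (q + r) <= Num.max (nrm q) (nrm r).
Proof.
have [->|q0] := eqVneq q 0; first by rewrite add0r le_max lexx orbT.
have [->|r0] := eqVneq r 0; first by rewrite addr0 le_max lexx.
have [->|s0] := eqVneq (q + r) 0.
  by rewrite padic_absq0 le_max padic_absq_ge0.
pose d := denq q * denq r.
pose a := numq q * denq r; pose b := numq r * denq q.
have d0 : d != 0 by rewrite mulf_neq0.
have Eq : q = a%:~R / d%:~R.
  rewrite !intrM -mulf_div divq_num_den divff ?mulr1 ?intr_eq0 //.
have Er : r = b%:~R / d%:~R.
  rewrite /d [denq q * _]mulrC !intrM -mulf_div divq_num_den divff ?mulr1 //.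
  by rewrite ?intr_eq0.
have Es : q + r = (a + b)%:~R / d%:~R by rewrite Eq Er -mulrDl -intrD.
have a0 : a != 0 by rewrite mulf_neq0 ?numq_eq0.
have b0 : b != 0 by rewrite mulf_neq0 ?numq_eq0.
have c0 : a + b != 0.
  by apply: contraNneq s0 => c0; rewrite Es c0 mul0r.
rewrite Es Eq Er !padic_absq_frac //.
have [pp|_] := boolP (prime p); last by rewrite !exp1rz le_max lexx.
have p1 : 1 < p%:R :> rat by rewrite ltr1n prime_gt1.
rewrite le_max !ler_eXz2l // !lerD2l !lerN2 !lez_nat -geq_min.
rewrite -pfactor_dvdn ?absz_gt0 //.
set k := minn _ _.
have ka : (p ^ k %| `|a|)%N by rewrite pfactor_dvdn ?absz_gt0 // geq_minl.
have kb : (p ^ k %| `|b|)%N by rewrite pfactor_dvdn ?absz_gt0 // geq_minr.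
have : ((p ^ k)%:Z %| a + b)%Z by apply: rpredD; rewrite dvdzE.
by rewrite dvdzE.
Qed.

Lemma padic_absqB q r : nrm (q - r) <= Num.max (nrm q) (nrm r).
Proof. by rewrite -(padic_absqN r); exact: padic_absqD. Qed.

End PadicAbsq.

Definition padic_cauchy (p : nat) : pred (nat -> rat) := [pred u |
  `[< forall e : rat, 0 < e -> exists N : nat, forall i j : nat,
      (N <= i)%N -> (N <= j)%N -> padic_absq p (u i - u j) < e >]].

Section CauchySequences.
Variable p : nat.
Local Notation nrm := (padic_absq p).

Lemma padic_cauchyP (u : nat -> rat) :
  reflect (forall e : rat, 0 < e -> exists N : nat, forall i j : nat,
             (N <= i)%N -> (N <= j)%N -> nrm (u i - u j) < e)
          (u \in padic_cauchy p).
Proof. exact: asboolP. Qed.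

Lemma padic_cauchy_bounded (u : nat -> rat) : u \in padic_cauchy p ->
  exists2 B : rat, 0 < B & exists N : nat, forall i, (N <= i)%N -> nrm (u i) <= B.
Proof.
move=> /padic_cauchyP /(_ 1 ltr01) [N uN].
exists (Num.max 1 (nrm (u N))); first by rewrite lt_max ltr01.
exists N => i Ni; rewrite -[u i](subrK (u N)).
apply: le_trans (padic_absqD _ _ _) _.
by rewrite ge_max !le_max (ltW (uN _ _ _ _)) //= lexx orbT.
Qed.

Lemma padic_cauchy_subring : subring_closed (padic_cauchy p).
Proof.
split.
- apply/padic_cauchyP => e e0; exists 0%N => i j _ _.
  by rewrite /GRing.one /= /cst subrr padic_absq0.
- move=> u v /padic_cauchyP cu /padic_cauchyP cv; apply/padic_cauchyP => e e0.
  have [N uN] := cu e e0; have [M vM] := cv e e0.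
  exists (maxn N M) => i j; rewrite !geq_max => /andP[Ni Mi] /andP[Nj Mj].
  rewrite !fctE; have -> : u i - v i - (u j - v j) = u i - u j - (v i - v j).
    by ring.
  by apply: le_lt_trans (padic_absqB _ _ _) _; rewrite gt_max uN ?vM.
- move=> u v cu cv.
  have [A A0 [N1 uA]] := padic_cauchy_bounded cu.
  have [B B0 [N2 vB]] := padic_cauchy_bounded cv.
  move: cu cv => /padic_cauchyP cu /padic_cauchyP cv; apply/padic_cauchyP => e e0.
  have [N3 uN] := cu (e / B) (divr_gt0 e0 B0).
  have [N4 vN] := cv (e / A) (divr_gt0 e0 A0).
  exists (maxn (maxn N1 N2) (maxn N3 N4)) => i j; rewrite !geq_max.
  move=> /andP[/andP[i1 i2] /andP[i3 i4]] /andP[/andP[j1 j2] /andP[j3 j4]].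
  rewrite !fctE.
  have -> : u i * v i - u j * v j = (u i - u j) * v i + u j * (v i - v j).
    by ring.
  apply: le_lt_trans (padic_absqD _ _ _) _; rewrite !padic_absqM gt_max.
  apply/andP; split.
    apply: le_lt_trans (_ : nrm (u i - u j) * B < e).
      by rewrite ler_wpM2l ?padic_absq_ge0 ?vB.
    by rewrite -ltr_pdivlMr ?uN.
  apply: le_lt_trans (_ : A * nrm (v i - v j) < e).
    by rewrite ler_wpM2r ?padic_absq_ge0 ?uA.
  by rewrite mulrC -ltr_pdivlMr ?vN.
Qed.

HB.instance Definition _ :=
  GRing.isSubringClosed.Build (nat -> rat) (padic_cauchy p) padic_cauchy_subring.

Record padic_seq :=
  PadicSeq { padic_seq_val :> nat -> rat ; _ : padic_seq_val \in padic_cauchy p }.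

HB.instance Definition _ := [isSub for padic_seq_val].
HB.instance Definition _ := [Choice of padic_seq by <:].
HB.instance Definition _ := [SubChoice_isSubComNzRing of padic_seq by <:].

Definition padic_null : pred padic_seq := [pred u : padic_seq |
  `[< forall e : rat, 0 < e -> exists N : nat, forall i : nat,
      (N <= i)%N -> nrm (u i) < e >]].

Lemma padic_nullP (u : padic_seq) :
  reflect (forall e : rat, 0 < e -> exists N : nat, forall i : nat,
             (N <= i)%N -> nrm (u i) < e) (u \in padic_null).
Proof. exact: asboolP. Qed.

Lemma padic_null_ideal : idealr_closed padic_null.
Proof.
split.
- by apply/padic_nullP => e e0; exists 0%N => i _; rewrite padic_absq0.
- apply/padic_nullP => /(_ 1 ltr01) [N /(_ N (leqnn N))].
  by rewrite padic_absq1 ltxx.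
- move=> a u v /padic_nullP nu /padic_nullP nv; apply/padic_nullP => e e0.
  have [A A0 [N1 aA]] := padic_cauchy_bounded (valP a).
  have [N2 uN] := nu (e / A) (divr_gt0 e0 A0); have [N3 vN] := nv e e0.
  exists (maxn N1 (maxn N2 N3)) => i; rewrite !geq_max => /and3P[i1 i2 i3].
  have -> : (a * u + v : padic_seq) i = a i * u i + v i by [].
  apply: le_lt_trans (padic_absqD _ _ _) _; rewrite gt_max vN // andbT padic_absqM.
  apply: le_lt_trans (_ : A * nrm (u i) < e).
    by rewrite ler_wpM2r ?padic_absq_ge0 ?aA.
  by rewrite mulrC -ltr_pdivlMr ?uN.
Qed.

HB.instance Definition _ := isIdealr.Build padic_seq padic_null padic_null_ideal.

End CauchySequences.

(* The completion of the rationals: Cauchy sequences modulo null sequences. *)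
Definition Qp (p : nat) : Type := {ideal_quot (@padic_null p : idealr (padic_seq p))}.

Section PadicField.
Variable p : nat.
Local Notation nrm := (padic_absq p).

HB.instance Definition _ := GRing.ComNzRing.on (Qp p).
HB.instance Definition _ := EqQuotient.on (Qp p).

Lemma padic_absqV (q : rat) : nrm q^-1 = (nrm q)^-1.
Proof.
have [->|q0] := eqVneq q 0; first by rewrite invr0 padic_absq0.
have n0 : nrm q != 0 by rewrite gt_eqF ?padic_absq_gt0.
by apply: (mulfI n0); rewrite -padic_absqM !divff ?padic_absq1.
Qed.

Lemma padic_seq_not_null (u : padic_seq p) : u \notin @padic_null p ->
  exists2 e : rat, 0 < e & exists N : nat, forall i, (N <= i)%N -> e <= nrm (u i).
Proof.
move=> /padic_nullP/existsNP[e /not_implyP[e0 nu]]; exists e => //.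
have /padic_cauchyP/(_ e e0)[N uN] := valP u; exists N => i Ni.
rewrite leNgt; apply/negP => uie; apply: nu; exists N => j Nj.
rewrite -[u j](subrK (u i)); apply: le_lt_trans (padic_absqD _ _ _) _.
by rewrite gt_max uie uN.
Qed.

Lemma padic_seqV_subproof (u : padic_seq p) : u \notin @padic_null p ->
  (fun i => (u i)^-1) \in padic_cauchy p.
Proof.
move=> /padic_seq_not_null[e e0 [N uN]]; apply/padic_cauchyP => d d0.
have /padic_cauchyP/(_ (d * (e * e)))[|M uM] := valP u.
  by rewrite !mulr_gt0.
exists (maxn N M) => i j; rewrite !geq_max => /andP[Ni Mi] /andP[Nj Mj].
have nz k : (N <= k)%N -> u k != 0.
  by move=> /uN; apply: contraTneq => ->; rewrite padic_absq0 -ltNge.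
have -> : (u i)^-1 - (u j)^-1 = (u j - u i) * ((u i)^-1 * (u j)^-1).
  by field; rewrite !nz.
rewrite !padic_absqM !padic_absqV -invfM.
have ee : 0 < nrm (u i) * nrm (u j).
  by rewrite mulr_gt0 // padic_absq_gt0 ?nz.
rewrite ltr_pdivrMr //; apply: lt_le_trans (uM j i Mj Mi) _.
rewrite ler_pM2l //; apply: ler_pM; rewrite ?uN //; exact: ltW.
Qed.

Lemma Qp_mulVf_ex (x : Qp p) : x != 0 -> exists y : Qp p, y * x = 1.
Proof.
move=> x0; pose u : padic_seq p := repr x.
have xE : x = \pi_(Qp p)%qT u by rewrite reprK.
have nu : u \notin @padic_null p.
  apply: contra x0 => nu; rewrite xE; apply/eqP.
  rewrite -(rmorph0 (\pi_(Qp p)%qT : {rmorphism padic_seq p -> Qp p})).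
  by apply/eqP; rewrite -Quotient.idealrBE subr0.
pose v := PadicSeq (padic_seqV_subproof nu).
exists (\pi_(Qp p)%qT v); rewrite xE.
rewrite -[LHS]Quotient.pi_mul -[RHS](rmorph1 \pi_(Qp p)%qT).
apply/eqP; rewrite -Quotient.idealrBE; apply/padic_nullP => d d0.
have [e e0 [N uN]] := padic_seq_not_null nu; exists N => i Ni.
have -> : (v * u - 1 : padic_seq p) i = (u i)^-1 * u i - 1 by [].
rewrite mulVf ?subrr ?padic_absq0 //.
by move: (uN i Ni); apply: contraTneq => ->; rewrite padic_absq0 -ltNge.
Qed.

Definition Qp_inv (x : Qp p) : Qp p :=
  if pselect (x != 0) is left x0 then projT1 (cid (Qp_mulVf_ex x0)) else 0.

Lemma Qp_mulVf (x : Qp p) : x != 0 -> Qp_inv x * x = 1.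
Proof.
by move=> x0; rewrite /Qp_inv; case: pselect => // y0; case: cid.
Qed.

Lemma Qp_inv0 : Qp_inv 0 = 0.
Proof. by rewrite /Qp_inv; case: pselect => // x0; case/eqP: (x0). Qed.

HB.instance Definition _ := GRing.ComNzRing_isField.Build (Qp p) Qp_mulVf Qp_inv0.

End PadicField.

Definition padic_abs (R : realType) (p : nat) (x : Qp p) : R :=
  limn (fun i : nat => ratr (padic_absq p ((repr x : padic_seq p) i)) : R).

Section PadicAbs.
Variables (R : realType) (p : nat).
Local Notation nrm := (padic_absq p).
Local Notation abs := (@padic_abs R p).
Local Notation pi := (\pi_(Qp p)%qT).
Implicit Types u v : padic_seq p.

Let rnrm u : nat -> R := fun i => ratr (nrm (u i)).

Lemma padic_null_cvg0 u : u \in @padic_null p -> rnrm u @ \oo --> 0.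
Proof.
move=> /padic_nullP nu; apply/cvgr0Pnorm_lt => e e0.
have [q] := rat_in_itvoo e0; rewrite in_itv /= => /andP[q0 qe].
rewrite ltr0q in q0; have [N uN] := nu q q0.
exists N => // i /= Ni; rewrite ger0_norm ?ler0q ?padic_absq_ge0 //.
by apply: lt_trans qe; rewrite ltr_rat uN.
Qed.

Lemma padic_absq_is_cvg u : cvgn (rnrm u).
Proof.
have [/padic_null_cvg0/cvgP//|nu] := boolP (u \in @padic_null p).
have [e e0 [N uN]] := padic_seq_not_null nu.
have /padic_cauchyP/(_ e e0)[M uM] := valP u.
apply: (@is_cvg_near_cst _ _ (rnrm u (maxn N M))).
exists (maxn N M) => // i /=; rewrite geq_max => /andP[Ni Mi].
have le k l : (maxn N M <= k)%N -> (maxn N M <= l)%N -> nrm (u k) <= nrm (u l).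
  rewrite !geq_max => /andP[Nk Mk] /andP[Nl Ml].
  rewrite -[u k](subrK (u l)); apply: le_trans (padic_absqD _ _ _) _.
  by rewrite ge_max lexx andbT (le_trans (ltW (uM _ _ _ _)) (uN _ _)).
by rewrite /rnrm; congr ratr; apply/eqP; rewrite eq_le !le // geq_max Ni.
Qed.

Lemma padic_abs_pi u : rnrm u @ \oo --> abs (pi u).
Proof.
set v : padic_seq p := repr (pi u).
have nuv : u - v \in @padic_null p by rewrite Quotient.idealrBE reprK.
have cu := @padic_absq_is_cvg u; have cv := @padic_absq_is_cvg v.
suff : rnrm u - rnrm v @ \oo --> 0.
  move=> /cvg_lim; rewrite limB // => /(_ (@Rhausdorff R))/eqP.
  by rewrite subr_eq0 => /eqP uv; have <- : limn (rnrm u) = abs (pi u) by [].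
apply/cvgr0Pnorm_lt => e e0.
have /cvgr0Pnorm_lt/(_ e e0) := padic_null_cvg0 nuv.
apply: filterS => i; apply: le_lt_trans.
rewrite [X in _ <= X]ger0_norm ?ler0q ?padic_absq_ge0 //.
rewrite /rnrm !fctE -rmorphB -ratr_norm ler_rat.
have dist a b : nrm a - nrm b <= nrm (a - b).
  rewrite lerBlDr -{1}[a](subrK b); apply: le_trans (padic_absqD _ _ _) _.
  by rewrite ge_max lerDl lerDr !padic_absq_ge0.
suff distn a b : `|nrm a - nrm b| <= nrm (a - b) by exact: distn.
by rewrite ler_norml dist andbT lerNl opprB -[a - b]opprB padic_absqN dist.
Qed.

Lemma padic_abs_repr (x : Qp p) : rnrm (repr x) @ \oo --> abs x.
Proof. by rewrite -{2}[x]reprK; exact: padic_abs_pi. Qed.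

Lemma padic_abs_ge0 x : 0 <= abs x.
Proof.
apply: limr_ge; first exact: padic_absq_is_cvg.
by apply: nearW => i; rewrite ler0q padic_absq_ge0.
Qed.

Lemma padic_abs0 : abs 0 = 0.
Proof.
rewrite -(rmorph0 pi); apply: (cvg_unique (@Rhausdorff R) (@padic_abs_pi 0)).
by apply: padic_null_cvg0; rewrite rpred0.
Qed.

Lemma padic_abs0_eq0 x : abs x = 0 -> x = 0.
Proof.
move=> x0; apply/eqP; apply: contraPT (x0) => nx; apply/eqP.
have nu : (repr x : padic_seq p) \notin @padic_null p.
  apply: contra nx => nu; rewrite -[x]reprK -(rmorph0 pi).
  by rewrite -Quotient.idealrBE subr0.
have [e e0 [N uN]] := padic_seq_not_null nu.
rewrite gt_eqF //; apply: lt_le_trans (_ : ratr e <= _).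
  by rewrite ltr0q.
apply: limr_ge; first exact: padic_absq_is_cvg.
by exists N => // i /= Ni; rewrite ler_rat uN.
Qed.

Lemma padic_absN x : abs (- x) = abs x.
Proof.
rewrite -{1}[x]reprK -rmorphN.
apply: (cvg_unique (@Rhausdorff R) (@padic_abs_pi (- repr x))).
rewrite (_ : rnrm (- repr x) = rnrm (repr x)); first exact: padic_abs_repr.
by apply/funext => i; congr (ratr _); exact: padic_absqN.
Qed.

Lemma padic_absD x y : abs (x + y) <= abs x + abs y.
Proof.
rewrite -{1}[x]reprK -{1}[y]reprK -rmorphD.
apply: (ler_cvg_to (@padic_abs_pi (repr x + repr y))
  (cvgD (@padic_abs_repr x) (@padic_abs_repr y))).
apply: nearW => i; rewrite /rnrm fctE -rmorphD ler_rat.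
apply: le_trans (padic_absqD _ _ _) _.
by rewrite ge_max lerDl lerDr !padic_absq_ge0.
Qed.

End PadicAbs.

Definition padic_int (R : realType) (p : nat) : set (Qp p) :=
  [set x | padic_abs R x <= 1].

(* The metric takes values in [R], hence the extra argument [R]. *)
Definition padic_mx (R : realType) (p m n : nat) : Type := 'M[Qp p]_(m, n).

Section PadicMatrixMetric.
Variables (R : realType) (p m n : nat).
Local Notation T := (padic_mx R p m n).
Implicit Types X Y Z : T.

HB.instance Definition _ := GRing.Zmodule.on T.

Definition padic_mx_dist X Y : R :=
  \big[Num.max/0]_(i < m) \big[Num.max/0]_(j < n) padic_abs R (X i j - Y i j).

Lemma padic_mx_dist_ler X Y (e : R) : 0 <= e ->
  reflect (forall i j, padic_abs R (X i j - Y i j) <= e) (padic_mx_dist X Y <= e).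
Proof.
move=> e0; apply: (iffP idP) => [h i j|h].
  apply: le_trans h; apply: le_trans (le_bigmax _ _ i).
  exact: (le_bigmax _ (fun j => padic_abs R (X i j - Y i j)) j).
by apply: bigmax_le => // i _; apply: bigmax_le.
Qed.

Lemma padic_mx_dist_ge0 X Y : 0 <= padic_mx_dist X Y.
Proof. exact: bigmax_ge_id. Qed.

Lemma padic_mx_distxx X : padic_mx_dist X X = 0.
Proof.
apply/eqP; rewrite eq_le padic_mx_dist_ge0 andbT.
by apply/padic_mx_dist_ler => // i j; rewrite subrr padic_abs0.
Qed.

Lemma padic_mx_dist_eq0 X Y : padic_mx_dist X Y = 0 -> X = Y.
Proof.
move=> XY; apply/matrixP => i j; apply/eqP; rewrite -subr_eq0; apply/eqP.
apply: (@padic_abs0_eq0 R); apply/eqP; rewrite eq_le padic_abs_ge0 andbT.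
by move: i j; apply/padic_mx_dist_ler; rewrite ?XY.
Qed.

Lemma padic_mx_dist_sym X Y : padic_mx_dist X Y = padic_mx_dist Y X.
Proof.
apply: eq_bigr => i _; apply: eq_bigr => j _.
by rewrite -padic_absN opprB.
Qed.

Lemma padic_mx_dist_triangle Y X Z :
  padic_mx_dist X Z <= padic_mx_dist X Y + padic_mx_dist Y Z.
Proof.
apply/padic_mx_dist_ler => [|i j]; first by rewrite addr_ge0 ?padic_mx_dist_ge0.
rewrite -[X i j](subrK (Y i j)) -addrA; apply: le_trans (padic_absD _ _ _) _.
by apply: lerD; move: i j; apply/padic_mx_dist_ler;
  rewrite ?padic_mx_dist_ge0 ?lexx.
Qed.

HB.instance Definition _ := isMetric.Build R T padic_mx_distxx
  padic_mx_dist_eq0 padic_mx_dist_sym padic_mx_dist_triangle.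

End PadicMatrixMetric.

Section Hausdorff.
Local Open Scope ereal_scope.
Variables (R : realType) (T : metricType R).

(* The supremum is taken together with 0, so that the empty set has
   diameter 0 rather than [-oo]. *)
Definition diameter (A : set T) : \bar R :=
  ereal_sup [set e | e = 0 \/ exists x y, [/\ A x, A y & e = (mdist x y)%:E]].

(* [diam(A)^s], where the empty set contributes 0 also for [s = 0]. *)
Definition hausdorff_weight (s : R) (A : set T) : \bar R :=
  if A == set0 then 0 else diameter A `^ s.

(* The empty set is allowed in a cover, so finite covers are included. *)
Definition hausdorff_content (s delta : R) (E : set T) : \bar R :=
  ereal_inf [set \sum_(i <oo) hausdorff_weight s (U i) | U in
    [set U : (set T)^nat | E `<=` \bigcup_i U i /\
                           forall i, diameter (U i) <= delta%:E]].

Definition hausdorff_measure (s : R) (E : set T) : \bar R :=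
  ereal_sup [set hausdorff_content s delta E | delta in [set d : R | (0 < d)%R]].

Definition hausdorff_dim (E : set T) : \bar R :=
  ereal_inf [set s%:E | s in [set s : R | (0 <= s)%R /\ hausdorff_measure s E = 0]].

End Hausdorff.

Definition int_height (k : nat) (a : 'rV[int]_k) : nat := \max_(i < k) `|a 0%R i|%N.

(* [lsubmx a] is the row vector [a_0] of the first [m] coordinates of [a], and
   [(a_0 *m X) 0 i] is its product with the i-th column of [X]. *)
Definition padic_well_approx (R : realType) (p n m : nat)
    (Psi : 'rV[int]_(m + n) -> 'I_n -> R) : set (padic_mx R p m n) :=
  [set X : padic_mx R p m n | (forall i j, padic_int R (X i j)) /\
    infinite_set [set a : 'rV[int]_(m + n) | forall i : 'I_n,
      padic_abs R ((map_mx intr (lsubmx a) *m X) 0 i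
                   - (rsubmx a 0 i)%:~R) < Psi a i]].

Definition power_psi (R : realType) (k n : nat) (tau : 'I_n -> R)
    (a : 'rV[int]_k) (i : 'I_n) : R :=
  (int_height a)%:R `^ (- tau i).

(* Main.v *)
Require Import Defs.
From mathcomp Require Import all_boot all_order all_algebra ring_quotient.
From mathcomp Require Import all_classical all_reals all_analysis.
From mathcomp Require Import ring lra zify.

Set Implicit Arguments.
Unset Strict Implicit.
Unset Printing Implicit Defensive.

Import Order.TTheory GRing.Theory Num.Theory.
Import numFieldNormedType.Exports.

Local Open Scope ring_scope.

(** Write d = m n.  Everything about a ball of radius p^(-l) in the space of
p-adic integral m x n matrices is a statement about one class of integer
matrices modulo p^l, so that Haar measure becomes the counting of residues
modulo a large power p^E, and the condition on X and a = (a_0, a_1, ..., a_n)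
becomes the system of congruences a_0 X_i = a_i modulo p^(e_i), with e_i just
above tau_i log_p |a|.

One count is used on both sides.  The proportion of matrices X for which some
nonzero a of height at most p^t solves the system modulo p^(g_i) is at most a
constant times p^(t (m + n) - sum g_i), uniformly in every fixed ball
([card_has_short]).  This is the expected number of solutions a; the point is
that multiples a = p^v a' do not spoil it.  The vector a' only solves the
system modulo p^(g_i - v), but v is at most t, and every g_i exceeds t because
every tau_i exceeds 1.

Upper bound.  Let f j denote the j-th term of the minimum and fix j.  The
points approximated by vectors of height about p^h are covered by classes
modulo p^(e_j); by the count there are at most a constant times p^(d e_j + h (m
+ n) - sum_i min (e_i, e_j)) of them.  The sum over h of this number times p^(-
t e_j) converges as soon as t is larger than f j ([hausdorff_measure_zero]).

Lower bound.  For a scale h choose U with sum_i min (e_i, U) close to h (m + n).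
By the pigeonhole principle every X has a nonzero a of height at most p^h which
solves the congruences modulo p^(min (e_i, U)), up to a bounded loss, and by the
count at least half of every ball consists of points X for which no much shorter
vector does.  For those X the solutions a are separated, so that few of them
concern a given ball ([card_selected_le]).  Consequently the uniform measure
nu_h on the points satisfying the full congruences modulo p^(e_i), scaled by the
inverse of their density, gives to every ball of radius r a mass bounded by
C r^d when r is at least p^(-U) and by C r^s for all r ([scale_measure]).  The
second bound requires sum_i min (x, tau_i) - (m + n) <= x (d - s) for every
x > 0; this is the inequality s <= f j at x = tau_j, and it extends to all x
because the left side is concave and piecewise linear with breaks at the tau_j
([min_sum_bound]).

A single scale gives a ball I of radius rho the mass rho^d only.  Adding about
rho^(s - d) scales, each much finer than the one before, raises this to rho^s
and costs a constant factor in the bound on the mass of small balls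
([local_measure]).  Hence each ball I carries measures, supported on balls of
good approximation of arbitrarily large height, which charge every ball of
radius r by at most K (r / rho)^s of the mass of I.

Finally let a countable family of balls B_i be given.  If no B_i contains I and
the sum of K (r_i / rho)^s over the B_i in I is less than 1, averaging against
such a measure finds a smaller ball, all of whose points are well approximated
once more, with the same property ([good_leaf]); iterating leads to a point of
the set outside all B_i ([uncovered_point]).  When all B_i have radius at most
p^(-k), some ball of radius p^(-k) has the property to start with unless the
sum of the r_i^s is at least p^(k (d - s)) / K, because there are p^(k d) such
balls ([initial_leaf]).  As s < d, this tends to infinity with k, which proves
that the s-dimensional measure is infinite; in particular the dimension is at
least s. *)

(** * Integer matrices modulo powers of p *)

Section Residues.
Variables (p m n : nat).
Hypothesis p_pr : prime p.
Implicit Types (X Y A : 'M[int]_(m, n)) (a : 'rV[int]_(m + n)) (k l E : nat).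

(** The bound is written as a successor so that [inord] applies; for p prime
it is p ^ E. *)
Definition resmx E := 'M['I_(p ^ E).-1.+1]_(m, n).
Definition reprmx E (X : resmx E) : 'M[int]_(m, n) := map_mx (fun x => (val x)%:Z) X.
Definition redmx E X : resmx E :=
  map_mx (fun x : int => inord `|(x %% (p ^ E)%N%:Z)%Z|%N) X.

Definition congmx l X Y : bool :=
  [forall i, forall j, ((p ^ l)%N%:Z %| X i j - Y i j)%Z].

Lemma congmxP l X Y :
  reflect (forall i j, ((p ^ l)%N%:Z %| X i j - Y i j)%Z) (congmx l X Y).
Proof. by apply: (iffP 'forall_forallP). Qed.

Lemma congmx_sym l X Y : congmx l X Y = congmx l Y X.
Proof.
by apply/congmxP/congmxP => h i j; rewrite -opprB rpredN.
Qed.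

Lemma congmx_trans l Y X Z : congmx l X Y -> congmx l Y Z -> congmx l X Z.
Proof.
move=> /congmxP h /congmxP h'; apply/congmxP => i j.
by rewrite -[X i j](subrK (Y i j)) -addrA rpredD.
Qed.

Lemma congmx_eqr l X Y Z : congmx l X Y -> congmx l X Z = congmx l Y Z.
Proof.
move=> h; apply/idP/idP; last exact: congmx_trans.
by apply: congmx_trans; rewrite congmx_sym.
Qed.

Lemma dvdz_pexp_le (k l : nat) (x : int) : (k <= l)%N ->
  ((p ^ l)%N%:Z %| x)%Z -> ((p ^ k)%N%:Z %| x)%Z.
Proof. by move=> kl; apply: dvdz_trans; rewrite dvdzE /=; apply: dvdn_exp2l. Qed.

Lemma congmx_le k l X Y : (k <= l)%N -> congmx l X Y -> congmx k X Y.
Proof. by move=> kl /congmxP h; apply/congmxP => i j; apply: dvdz_pexp_le (h i j). Qed.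

Lemma expp_gt0 k : (0 < p ^ k)%N.
Proof. by rewrite expn_gt0 prime_gt0. Qed.

Lemma congmx0 X Y : congmx 0 X Y.
Proof. by apply/congmxP => i j; rewrite expn0 dvd1z. Qed.

Lemma expz_neq0 k : (p ^ k)%N%:Z != 0 :> int.
Proof. by have := expp_gt0 k; lia. Qed.

Lemma reprmx_redmx E X : congmx E (reprmx (redmx E X)) X.
Proof.
have q0 := expz_neq0 E.
have mod0 (x : int) : 0 <= (x %% (p ^ E)%N)%Z by rewrite modz_ge0.
apply/congmxP => i j; rewrite !mxE /= inordK.
  by rewrite gez0_abs // -eqz_mod_dvd modz_mod.
by rewrite prednK ?expp_gt0 // -ltz_nat gez0_abs // ltz_mod.
Qed.

Lemma redmx_eq E X Y : congmx E X Y -> redmx E X = redmx E Y.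
Proof.
move=> /congmxP h; apply/matrixP => i j; rewrite !mxE; congr (inord `|_|%N).
by apply/eqP; rewrite eqz_mod_dvd.
Qed.

Lemma congmx_inj E (X Y : resmx E) : congmx E (reprmx X) (reprmx Y) -> X = Y.
Proof.
move=> /congmxP h; apply/matrixP => i j; have := h i j; rewrite !mxE.
have lt (x : 'I_(p ^ E).-1.+1) : (x < p ^ E)%N.
  by rewrite -[X in (_ < X)%N]prednK ?expp_gt0.
rewrite -eqz_mod_dvd !modz_small ?ltz_nat ?lt //.
by move=> /eqP [] /val_inj.
Qed.

Lemma reprmxK E (X : resmx E) : redmx E (reprmx X) = X.
Proof. by apply: congmx_inj; exact: reprmx_redmx. Qed.

Lemma card_resmx E : #|{: resmx E}| = (p ^ (E * (m * n)))%N.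
Proof. by rewrite card_mx card_ord prednK ?expp_gt0 // -expnM. Qed.

(** Multiplying by p^l and translating by A identifies the class of A modulo
p^l with all matrices modulo p^(E - l). *)
Lemma card_class E l A : (l <= E)%N ->
  #|[pred X : resmx E | congmx l (reprmx X) A]| = (p ^ ((E - l) * (m * n)))%N.
Proof.
move=> lE; rewrite -card_resmx.
pose f (Y : resmx (E - l)) : resmx E := redmx E (A + (p ^ l)%N%:Z *: reprmx Y).
have pl : (p ^ E)%N%:Z = (p ^ l)%N%:Z * (p ^ (E - l))%N%:Z :> int.
  by rewrite -PoszM -expnD subnKC.
have pl0 := expz_neq0 l.
have f_inj : injective f.
  move=> Y Y' eqf; apply: congmx_inj; apply/congmxP => i j.
  have : congmx E (A + (p ^ l)%N%:Z *: reprmx Y) (A + (p ^ l)%N%:Z *: reprmx Y').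
    by rewrite -(congmx_eqr _ (reprmx_redmx E _)) -/(f Y) eqf reprmx_redmx.
  move=> /congmxP/(_ i j); rewrite !mxE opprD addrACA subrr add0r -mulrBr.
  by rewrite pl dvdz_mul2l.
rewrite -(card_imset _ f_inj); apply: eq_card => X; rewrite inE.
apply/idP/imsetP => [/congmxP h|[Y _ ->]]; last first.
  apply: congmx_trans (congmx_le lE (reprmx_redmx E _)) _; apply/congmxP => i j.
  by rewrite !mxE [A i j + _]addrC addrK dvdz_mulr.
pose Z : 'M[int]_(m, n) := \matrix_(i, j) ((reprmx X i j - A i j) %/ (p ^ l)%N%:Z)%Z.
exists (redmx _ Z) => //; apply: congmx_inj; rewrite congmx_sym.
apply: congmx_trans (reprmx_redmx E _) _; apply/congmxP => i j.
have hZ : (p ^ l)%N%:Z * Z i j = reprmx X i j - A i j.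
  by rewrite mxE mulrC divzK.
have := congmxP _ _ _ (reprmx_redmx (E - l) Z) i j; move: hZ.
rewrite !mxE => hZ; rewrite -(dvdz_mul2l pl0) -pl mulrBr.
by congr (dvdz _ _); rewrite hZ; ring.
Qed.

(** The error of the approximation of X by a. *)
Definition zform a X : 'rV[int]_n := lsubmx a *m X - rsubmx a.
Definition solves (e : 'I_n -> nat) a X : bool :=
  [forall i, ((p ^ e i)%N%:Z %| zform a X 0%R i)%Z].
(** A vector that solves congruences modulo p is divisible by p as soon as a_0
is, so only a_0 is tested. *)
Definition primitive a (j : 'I_m) : bool := ~~ (p%:Z %| lsubmx a 0%R j)%Z.

Lemma solvesP e a X :
  reflect (forall i, ((p ^ e i)%N%:Z %| zform a X 0%R i)%Z) (solves e a X).
Proof. exact: forallP. Qed.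

Lemma solves_le e e' a X : (forall i, e i <= e' i)%N ->
  solves e' a X -> solves e a X.
Proof.
by move=> le /solvesP h; apply/solvesP => i; apply: dvdz_pexp_le (h i).
Qed.

Lemma zformE a X i :
  zform a X 0 i = \sum_j lsubmx a 0 j * X j i - rsubmx a 0 i.
Proof. by rewrite !mxE; congr (_ - _); rewrite ?mxE. Qed.

Lemma zform_congmx l a X Y i : congmx l X Y ->
  ((p ^ l)%N%:Z %| zform a X 0%R i - zform a Y 0%R i)%Z.
Proof.
move=> /congmxP h; rewrite !zformE opprB addrA subrK -sumrB.
by apply: rpred_sum => j _; rewrite -mulrBr dvdz_mull.
Qed.

Lemma solves_congmx_imp e a X Y E : (forall i, e i <= E)%N -> congmx E X Y ->
  solves e a X -> solves e a Y.
Proof.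
move=> le XY /solvesP h; apply/solvesP => i.
have -> : zform a Y 0 i = zform a X 0 i - (zform a X 0 i - zform a Y 0 i) by ring.
by rewrite rpredB //; apply: dvdz_pexp_le (le i) _; apply: zform_congmx.
Qed.

Lemma solves_congmx e a X Y E : (forall i, e i <= E)%N -> congmx E X Y ->
  solves e a X = solves e a Y.
Proof.
move=> le XY; apply/idP/idP; apply: solves_congmx_imp le _ => //.
by rewrite congmx_sym.
Qed.

Lemma zformB a a' X : zform (a - a') X = zform a X - zform a' X.
Proof.
by rewrite /zform !linearB /= mulmxBl; apply/matrixP => i j; rewrite !mxE; ring.
Qed.

Lemma zformZ (c : int) a X : zform (c *: a) X = c *: zform a X.
Proof.
have Zl : lsubmx (c *: a) = c *: lsubmx a by apply/matrixP => i j; rewrite !mxE.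
have Zr : rsubmx (c *: a) = c *: rsubmx a by apply/matrixP => i j; rewrite !mxE.
by rewrite /zform Zl Zr -scalemxAl -scalerBr.
Qed.

(** Row j of X is the one that multiplies a_0(j). When a_0(j) is prime to p,
moving X along it moves the error a_0 X_i through all residues, without
touching X_i modulo p^(f i). *)
Definition rowshift (f t : 'I_n -> nat) (j : 'I_m) : 'M[int]_(m, n) :=
  \matrix_(j', i) (if j' == j then ((t i) * p ^ f i)%N%:Z else 0).

Lemma zform_rowshift f t j a X i :
  zform a (X + rowshift f t j) 0 i = zform a X 0 i + lsubmx a 0 j * ((t i) * p ^ f i)%N%:Z.
Proof.
have -> : zform a (X + rowshift f t j) 0 i = zform a X 0 i + (lsubmx a *m rowshift f t j) 0 i.
  by rewrite /zform mulmxDr addrAC [LHS]mxE.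
congr (_ + _); rewrite mxE (bigD1 j) //= big1 => [|j' /negPf jj].
  by rewrite addr0 [rowshift _ _ _ _ _]mxE eqxx.
by rewrite [rowshift _ _ _ _ _]mxE jj mulr0.
Qed.

Lemma rowshift_congmx l f t j X : (forall i, l <= f i)%N -> congmx l (X + rowshift f t j) X.
Proof.
move=> lf; apply/congmxP => i k; rewrite !mxE [X i k + _]addrC addrK; case: ifP => // _.
by rewrite dvdzE /= dvdn_mull // dvdn_exp2l.
Qed.

Lemma card_dffun_ord (f : 'I_n -> nat) :
  #|{dffun forall i : 'I_n, 'I_(f i).-1.+1}| = (\prod_i (f i).-1.+1)%N.
Proof.
rewrite card_dep_ffun foldrE big_map big_enum /=.
by apply: eq_bigr => i _; rewrite card_ord.
Qed.

(** The translates of a solution by t_i p^l in row j, with t_i < p^(e_i - l),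
are distinct and stay in the class of A: the errors that they produce modulo
p^(e_i) are all different because a_0(j) is prime to p. The truncated
subtraction covers the case e_i <= l, where the congruence puts no further
restriction. *)
Lemma card_solutions_le E l A (e : 'I_n -> nat) a j :
  (l <= E)%N -> (forall i, e i <= E)%N ->
  primitive a j ->
  (#|[pred X : resmx E | congmx l (reprmx X) A && solves e a (reprmx X)]|
     * p ^ (\sum_i (e i - l)) <= p ^ ((E - l) * (m * n)))%N.
Proof.
move=> lE eE aj; rewrite -(card_class A lE) expn_sum.
pose T := {dffun forall i : 'I_n, 'I_(p ^ (e i - l)).-1.+1}.
have cT : #|{: T}| = (\prod_i p ^ (e i - l))%N.
  by rewrite card_dffun_ord; apply: eq_bigr => i _; rewrite prednK ?expp_gt0.
rewrite -cT -cardX.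
pose f (Xt : resmx E * T) : resmx E :=
  redmx E (reprmx Xt.1 + rowshift (fun=> l) (fun i => Xt.2 i) j).
set D := [predX _ & _].
have f_inj : {in D &, injective f}.
  move=> [X t] [X' t']; rewrite !inE /= !andbT => /andP[XA aX] /andP[XA' aX'] eqf.
  have ff : congmx E (reprmx X + rowshift (fun=> l) (fun i => t i) j)
                  (reprmx X' + rowshift (fun=> l) (fun i => t' i) j).
    rewrite -(congmx_eqr _ (reprmx_redmx E _)) -/(f (X, t)) eqf.
    exact: reprmx_redmx.
  have tt : t = t'.
    apply/ffunP => i; apply: val_inj => /=.
    have := dvdz_pexp_le (eE i) (zform_congmx a i ff); rewrite !zform_rowshift.
    move=> h.
    have {h}: ((p ^ e i)%N%:Z %| lsubmx a 0%R j * 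
      ((t i : nat)%:Z - (t' i : nat)%:Z) * (p ^ l)%N%:Z)%Z.
      move: aX aX' => /solvesP/(_ i) h1 /solvesP/(_ i) h2.
      have -> : lsubmx a 0 j * ((t i : nat)%:Z - (t' i : nat)%:Z) * (p ^ l)%N%:Z
        = (zform a (reprmx X) 0 i + lsubmx a 0 j * (t i * p ^ l)%N -
      (zform a (reprmx X') 0 i + lsubmx a 0 j * (t' i * p ^ l)%N)) - zform a (reprmx X) 0 i
        + zform a (reprmx X') 0 i by rewrite !PoszM; ring.
      by rewrite rpredD // rpredB.
    have lt (u : T) : (u i < p ^ (e i - l))%N.
      by rewrite -[X in (_ < X)%N]prednK ?expp_gt0.
    move: (lt t) (lt t'); move: (nat_of_ord (t i)) (nat_of_ord (t' i)) => x y.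
    case: (leqP (e i) l) => [|/ltnW] el.
      by rewrite (eqP el) expn0 => l1 l2 _; lia.
    have -> : (p ^ e i)%N%:Z = (p ^ (e i - l))%N%:Z * (p ^ l)%N%:Z :> int.
      by rewrite -PoszM -expnD subnK.
    move=> l1 l2; rewrite dvdz_mul2r; last exact: expz_neq0.
    rewrite Gauss_dvdzr; last first.
      by rewrite coprimezE /= coprimeXl // prime_coprime.
    rewrite -eqz_mod_dvd !modz_small ?ltz_nat //.
    by move=> /eqP [].
  subst t'; congr (_, _); apply: congmx_inj; apply/congmxP => i i'.
  by have := congmxP _ _ _ ff i i'; rewrite !mxE opprD addrACA subrr addr0.
rewrite -(card_in_imset f_inj); apply: subset_leq_card;
  apply/fintype.subsetP => Z /imsetP[[X t]].
rewrite !inE /= andbT => /andP[XA _] ->.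
apply: congmx_trans (congmx_le lE (reprmx_redmx E _)) _.
by apply: congmx_trans XA; apply: rowshift_congmx.
Qed.

End Residues.

(** * Short integer vectors *)

Lemma card_union_le (T U : finType) (D : {pred T}) (Q : pred U) (P : U -> {pred T}) :
  (forall X, X \in D -> exists y, Q y && (X \in P y)) ->
  (#|D| <= \sum_(y | Q y) #|P y|)%N.
Proof.
move=> h; under eq_bigr do rewrite -sum1_card big_mkcond.
rewrite exchange_big /= -sum1_card big_mkcond; apply: leq_sum => X _.
case: ifP => // /h [y /andP[Qy PX]].
by rewrite (bigD1 y) //= PX.
Qed.

Section Boxes.
Variables (m n : nat).
Implicit Types a : 'rV[int]_(m + n).

Definition height_le a (B : nat) := forall c, (`|a 0%R c| <= B)%N.

(** Integer vectors of height at most B, shifted by B so as to form a finite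
type. *)
Definition box B := 'rV['I_(2 * B).+1]_(m + n).
Definition boxZ B (x : box B) : 'rV[int]_(m + n) :=
  map_mx (fun y : 'I_(2 * B).+1 => (y : nat)%:Z - B%:Z) x.

Lemma boxZ_height_le B (x : box B) : height_le (boxZ x) B.
Proof. by move=> c; rewrite mxE; have := ltn_ord (x 0%R c); lia. Qed.

Lemma boxZ_surj B a : height_le a B -> exists x : box B, boxZ x = a.
Proof.
move=> h; exists (map_mx (fun z : int => inord `|z + B%:Z|) a).
apply/rowP => c; rewrite !mxE inordK; have := h c; lia.
Qed.

Lemma boxZ_inj B : injective (@boxZ B).
Proof.
move=> x y xy; apply/rowP => c; apply: val_inj => /=.
by move/rowP: xy => /(_ c); rewrite !mxE; lia.
Qed.

(** A vector is determined by its label and by the cell of side w in which it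
lies. The labels make it possible to apply the hypothesis to vectors in a
single coset of a lattice. *)
Lemma packing B (L : finType) (lb : box B -> L) (P : pred (box B))
    (w : 'I_(m + n) -> nat) : (forall c, 0 < w c)%N ->
  (forall x y, P x -> P y -> lb x = lb y ->
     (forall c, `|boxZ x 0%R c - boxZ y 0%R c| < w c)%N -> x = y) ->
  (#|P| <= #|L| * \prod_c (2 * B %/ w c).+1)%N.
Proof.
move=> w0 hP.
have <- : #|{dffun forall c : 'I_(m + n), 'I_(2 * B %/ w c).+1}| =
    (\prod_c (2 * B %/ w c).+1)%N.
  exact: (card_dffun_ord (fun c => (2 * B %/ w c).+1)).
rewrite -card_prod.
pose f (x : box B) : L * {dffun forall c : 'I_(m + n), 'I_(2 * B %/ w c).+1} :=
  (lb x, [ffun c => inord (x 0%R c %/ w c)]).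
apply: (@leq_card_in _ _ f) => x y xP yP [lxy] /ffunP fxy.
apply: hP => // c; have := fxy c; rewrite !ffunE => /(congr1 val) /=.
have le (z : box B) : (z 0%R c %/ w c < (2 * B %/ w c).+1)%N.
  by rewrite ltnS leq_div2r // -ltnS.
rewrite !inordK // => dxy; rewrite !mxE.
have := divn_eq (x 0%R c) (w c); have := divn_eq (y 0%R c) (w c).
have := ltn_pmod (x 0%R c) (w0 c); have := ltn_pmod (y 0%R c) (w0 c).
rewrite dxy; move: (y 0%R c %/ w c * w c)%N (x 0%R c %% w c)%N (y 0%R c %% w c)%N => q r r'.
by move: (w c) (nat_of_ord (x 0%R c)) (nat_of_ord (y 0%R c)); lia.
Qed.

End Boxes.

Section Vectors.
Variables (p m n : nat).
Hypothesis p_pr : prime p.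
Implicit Types (X Y A : 'M[int]_(m, n)) (a : 'rV[int]_(m + n)) (k l E : nat).
Local Notation expp_gt0 := (expp_gt0 p_pr).
Local Notation expz_neq0 := (expz_neq0 p_pr).
Local Notation box := (box m n).

(** Descent on the sum of the absolute values of the coordinates. *)
Lemma p_content a : a != 0 -> exists v a' c,
  a = (p ^ v)%N%:Z *: a' /\ ~~ (p%:Z %| a' 0%R c)%Z.
Proof.
have [N] := ubnP (\sum_c `|a 0%R c|)%N; elim: N a => // N IH a aN a0.
have [/forallP h|] := boolP [forall c, (p%:Z %| a 0%R c)%Z]; last first.
  by rewrite negb_forall => /existsP[c hc]; exists 0%N, a, c; rewrite expn0 scale1r.
pose b : 'rV[int]_(m + n) := map_mx (fun x => (x %/ p%:Z)%Z) a.
have ab : a = p%:Z *: b.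
  by apply/rowP => c; rewrite !mxE mulrC divzK.
have b0 : b != 0 by apply: contra_neq a0 => b0; rewrite ab b0 scaler0.
have bN : (\sum_c `|b 0%R c| < N)%N.
  have sp : (0 < \sum_c `|b 0%R c|)%N.
    rewrite lt0n; apply: contra b0 => /eqP/eqP; rewrite sum_nat_eq0 => /forallP b0.
    by apply/eqP/rowP => c; have := b0 c; rewrite /= absz_eq0 => /eqP ->; rewrite mxE.
  have : (2 * \sum_c `|b 0%R c| <= \sum_c `|a 0%R c|)%N.
    rewrite big_distrr /=; apply: leq_sum => c _; 
    have -> : a 0 c = p%:Z * b 0 c by rewrite {1}ab [LHS]mxE.
    rewrite abszM.
    by rewrite leq_mul2r prime_gt1 ?orbT.
  by move: aN sp; rewrite -ltnS; move: (\sum_c _)%N (\sum_c _)%N => x y; lia.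
have [v [a' [c [ba' hc]]]] := IH b bN b0.
by exists v.+1, a', c; split => //; rewrite ab ba' scalerA expnS PoszM.
Qed.

Lemma primitive_solves g a X c : (forall i, (0 < g i)%N) -> solves p g a X ->
  ~~ (p%:Z %| a 0%R c)%Z -> exists j, primitive p a j.
Proof.
move=> g0 /solvesP h hc; apply/existsP; rewrite -[[exists _, _]]negbK negb_exists.
apply/negP => /forallP np; have dl j : (p%:Z %| lsubmx a 0%R j)%Z by have := np j;
  rewrite negbK.
case: (split_ordP c) => j cj.
  by have := dl j; rewrite mxE -cj (negPf hc).
have : (p%:Z %| zform a X 0%R j)%Z.
  by have := dvdz_pexp_le (g0 j) (h j); rewrite expn1.
have dS : (p%:Z %| \sum_j' lsubmx a 0%R j' * X j' j)%Z.
  by apply: rpred_sum => i _; rewrite dvdz_mulr.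
move=> /(rpredB dS); rewrite zformE opprB addrC subrK mxE -cj => h'.
by rewrite h' in hc.
Qed.

(** The power of p that divides a is at most its height p^t, hence smaller
than all moduli; dividing it out therefore leaves nontrivial congruences,
which force the primitive part of a to have a coordinate of a_0 prime to p. *)
Lemma primitive_decomposition t g a X : a != 0 -> height_le a (p ^ t) -> solves p g a X ->
  (forall i, t < g i)%N ->
  exists v a' j, [/\ (v <= t)%N, a = (p ^ v)%N%:Z *: a', primitive p a' j,
    height_le a' (p ^ (t - v)) & solves p (fun i => g i - v)%N a' X].
Proof.
move=> a0 ah ag tg; have [v [a' [c [aE hc]]]] := p_content a0.
have a'v i : (p ^ v * `|a' 0%R i| <= p ^ t)%N.
  by have := ah i; rewrite aE mxE abszM.
have vt : (v <= t)%N.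
  rewrite -(leq_exp2l _ _ (prime_gt1 p_pr)); apply: leq_trans (a'v c).
  rewrite leq_pmulr // absz_gt0; apply: contraNneq hc => ->; exact: dvdz0.
have ag' : solves p (fun i => g i - v)%N a' X.
  apply/solvesP => i; move/solvesP: ag => /(_ i); rewrite aE zformZ mxE.
  have -> : (p ^ g i)%N%:Z = (p ^ v)%N%:Z * (p ^ (g i - v))%N%:Z :> int.
    by rewrite -PoszM -expnD subnKC // ltnW // (leq_ltn_trans vt).
  by rewrite dvdz_mul2l // expz_neq0.
have [i|j hj] := primitive_solves _ ag' hc.
  by rewrite subn_gt0 (leq_ltn_trans vt).
exists v, a', j; split=> // i.
by rewrite -(leq_pmul2l (expp_gt0 v)) -expnD subnKC.
Qed.

Definition residue (e : nat) (x : int) : 'I_(p ^ e).-1.+1 :=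
  inord `|(x %% (p ^ e)%N%:Z)%Z|%N.

Lemma residue_eq e x y : residue e x = residue e y -> ((p ^ e)%N%:Z %| x - y)%Z.
Proof.
move=> /(congr1 val) /=; rewrite !inordK; first last.
- rewrite prednK ?expp_gt0 // -ltz_nat gez0_abs ?modz_ge0 ?ltz_mod ?expz_neq0 //.
- rewrite prednK ?expp_gt0 // -ltz_nat gez0_abs ?modz_ge0 ?ltz_mod ?expz_neq0 //.
move=> /(congr1 Posz); rewrite !gez0_abs ?modz_ge0 ?expz_neq0 // => xy.
by rewrite -eqz_mod_dvd; apply/eqP.
Qed.

(** Dirichlet's theorem: there are more vectors with coordinates in [0, p^h]
than possible values of the n errors modulo p^(e_i), and the difference of two
vectors with the same errors is a solution. *)
Lemma padic_dirichlet X (e : 'I_n -> nat) h : (0 < m)%N -> (\sum_i e i <= h * (m + n))%N ->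
  exists a, [/\ a != 0, height_le a (p ^ h) & solves p e a X].
Proof.
move=> m0 eh; pose F := 'rV['I_(p ^ h).+1]_(m + n).
pose T := {dffun forall i : 'I_n, 'I_(p ^ e i).-1.+1}.
pose vz (x : F) : 'rV[int]_(m + n) := map_mx (fun y : 'I_ _ => (y : nat)%:Z) x.
pose f (x : F) : T := [ffun i => residue (e i) (zform (vz x) X 0 i)].
have cT : #|{: T}| = (p ^ (\sum_i e i))%N.
  rewrite (card_dffun_ord (fun i => p ^ e i)%N) expn_sum.
  by apply: eq_bigr => i _; rewrite prednK ?expp_gt0.
have : ~~ injectiveb f.
  apply/negP => /injectiveP /leq_card; rewrite cT card_mx card_ord mul1n.
  apply/negP; rewrite -ltnNge; apply: leq_ltn_trans (_ : (p ^ h) ^ (m + n) < _)%N.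
    by rewrite -expnM leq_exp2l ?prime_gt1.
  by rewrite ltn_exp2r ?addn_gt0 ?m0.
move=> /injectivePn[x [y xy /ffunP fxy]]; exists (vz x - vz y); split.
- rewrite subr_eq0; apply: contra_neq xy => xy; apply/rowP => c.
  by apply: val_inj; move/rowP: xy => /(_ c); rewrite !mxE => -[].
- move=> c; rewrite !mxE; have := ltn_ord (x 0%R c); have := ltn_ord (y 0%R c);
  move: (x 0%R c) (y 0%R c) => u u2; move: (p ^ h)%N (nat_of_ord u) (nat_of_ord u2). lia.
- apply/solvesP => i; rewrite zformB !mxE.
  by have := fxy i; rewrite !ffunE => /residue_eq; rewrite !mxE.
Qed.

Definition has_short t (g : 'I_n -> nat) X : bool :=
  [exists x : box (p ^ t), (boxZ x != 0) && solves p g (boxZ x) X].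

Lemma has_shortP t g X :
  reflect (exists a, [/\ a != 0, height_le a (p ^ t) & solves p g a X]) (has_short t g X).
Proof.
apply: (iffP existsP) => [[x /andP[x0 xg]]|[a [a0 ah ag]]].
  by exists (boxZ x); split=> //; exact: boxZ_height_le.
by have [x xa] := boxZ_surj ah; exists x; rewrite xa a0.
Qed.

Definition has_primitive h (e : 'I_n -> nat) X : bool :=
  [exists x : box (p ^ h), exists j, primitive p (boxZ x) j && solves p e (boxZ x) X].

Lemma has_primitiveP h e X :
  reflect (exists a j, [/\ primitive p a j, height_le a (p ^ h) & solves p e a X])
    (has_primitive h e X).
Proof.
apply: (iffP existsP) => [[x /existsP[j /andP[xj xe]]]|[a [j [aj ah ae]]]].
  by exists (boxZ x), j; split=> //; exact: boxZ_height_le.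
by have [x xa] := boxZ_surj ah; exists x; apply/existsP; exists j; rewrite xa aj.
Qed.

(** Divide the solution a given by Dirichlet's theorem, modulo p^(g_i + b), by
the power p^v that it contains. If v <= b the quotient still solves the
congruences modulo p^(g_i). If v > b then a / p^b would be a solution of
height at most p^(h - b), which is excluded. *)
Lemma good_has_primitive b h g X : (0 < m)%N -> (b <= h)%N ->
  (forall i, 0 < g i)%N -> (forall i, h < g i + b)%N ->
  (\sum_i (g i + b) <= h * (m + n))%N -> ~~ has_short (h - b) g X -> has_primitive h g X.
Proof.
move=> m0 bh g0 gh sg /negP nb; have [a [a0 ah ag]] := padic_dirichlet X m0 sg.
have [v [a' [j [vh aE a'j a'h a'g]]]] := primitive_decomposition a0 ah ag gh.
apply/has_primitiveP; exists a', j; split=> //.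
  by move=> c; apply: leq_trans (a'h c) _; rewrite leq_exp2l ?prime_gt1 ?leq_subr.
case: (leqP v b) => vb.
  by apply: solves_le a'g => i; rewrite -addnBA // leq_addr.
exfalso; apply: nb; apply/has_shortP; exists ((p ^ (v - b))%N%:Z *: a'); split.
- apply/eqP => /rowP/(_ (lshift n j)); rewrite !mxE; apply/eqP.
  rewrite mulf_neq0 ?expz_neq0 //; apply: contraNneq a'j => a'0.
  by rewrite mxE a'0 dvdz0.
- move=> c; rewrite mxE abszM; have -> : (h - b = v - b + (h - v))%N by lia.
  by rewrite expnD leq_mul2l a'h orbT.
- apply/solvesP => i; rewrite zformZ mxE.
  apply: (@dvdz_pexp_le _ _ (v - b + (g i + b - v))); first by lia.
  by rewrite expnD PoszM dvdz_mul //; exact: (solvesP _ _ _ _ a'g).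
Qed.

End Vectors.

(** * Counting the matrices with a short solution *)

Lemma sum_expn_le q t : (2 <= q)%N -> (\sum_(i < t.+1) q ^ (t - i) <= 2 * q ^ t)%N.
Proof.
move=> q2; elim: t => [|t IH]; first by rewrite big_ord1.
rewrite big_ord_recl subn0 /=.
apply: leq_trans (_ : q ^ t.+1 + 2 * q ^ t <= _)%N.
  by rewrite leq_add2l.
by rewrite [leqRHS]mul2n -addnn leq_add2l expnS leq_mul2r q2 orbT.
Qed.

Lemma leq_expn e x y : (x <= y)%N -> (x ^ e <= y ^ e)%N.
Proof. by move=> xy; elim: e => // e IH; rewrite !expnS leq_mul. Qed.

Section Counting.
Variables (p m n : nat).
Hypothesis p_pr : prime p.
Implicit Types (X Y A : 'M[int]_(m, n)) (a : 'rV[int]_(m + n)) (k l E : nat).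
Local Notation expp_gt0 := (expp_gt0 p_pr).
Local Notation resmx := (resmx p m n).
Local Notation box := (box m n).

(** The coordinates of a_0 are arbitrary; the others are then determined
modulo p^k. Both 2 B / p^k + 1 and the cases where B is smaller than p^k are
covered by 3 p^(t - v - k) with truncated subtraction. *)
Lemma card_primitive_box v k t A : (v <= t)%N ->
  (#|[pred x : box (p ^ (t - v)) | [exists j, primitive p (boxZ x) j] &&
       solves p (fun=> k) (boxZ x) A]|
   <= 3 ^ (m + n) * p ^ ((t - v) * m + n * (t - v - k)))%N.
Proof.
move=> vt; set P := [pred x : _ | _].
pose w (c : 'I_(m + n)) := if fintype.split c is inr _ then (p ^ k)%N else 1%N.
have w0 c : (0 < w c)%N by rewrite /w; case: fintype.split => // _; exact: expp_gt0.
have := @packing m n (p ^ (t - v)) unit (fun=> tt) P w w0.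
rewrite card_unit mul1n => packP; apply: leq_trans (packP _) _ => {packP}.
  move=> x y /andP[_ /solvesP xA] /andP[_ /solvesP yA] _ xy; apply: boxZ_inj.
  have xyl j : lsubmx (boxZ x) 0%R j = lsubmx (boxZ y) 0%R j.
    rewrite !mxE; have := xy (lshift n j).
    rewrite /w (unsplitK (inl j : 'I_m + 'I_n)) !mxE; lia.
  apply/rowP => c; case: (split_ordP c) => j ->.
    by have := xyl j; rewrite !mxE.
  have : ((p ^ k)%N%:Z %| boxZ x 0%R (rshift m j) - boxZ y 0%R (rshift m j))%Z.
    have := rpredB (yA j) (xA j); rewrite !zformE.
    rewrite (eq_bigr (fun j' => lsubmx (boxZ x) 0%R j' * A j' j)); last first.
      by move=> j' _; rewrite xyl.
    by rewrite opprB addrC subrKA [rsubmx (boxZ x) _ _]mxE [rsubmx (boxZ y) _ _]mxE.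
  have := xy (rshift m j); rewrite /w (unsplitK (inr j : 'I_m + 'I_n)).
  set u := boxZ x _ _; set u' := boxZ y _ _ => lt /dvdzP[z zE].
  move: lt; rewrite zE abszM absz_nat -{2}[(p ^ k)%N]mul1n ltn_mul2r => /andP[_ z0].
  by apply/eqP; rewrite -subr_eq0 zE (_ : z = 0) ?mul0r //; lia.
rewrite big_split_ord /=.
rewrite (eq_bigr (fun=> (2 * p ^ (t - v)).+1)); last first.
  by move=> j _; rewrite /w (unsplitK (inl j : 'I_m + 'I_n)) divn1.
rewrite [X in (_ * X <= _)%N](eq_bigr (fun=> (2 * p ^ (t - v) %/ p ^ k).+1)); last first.
  by move=> j _; rewrite /w (unsplitK (inr j : 'I_m + 'I_n)).
rewrite !prod_nat_const !card_ord expnD expnD mulnACA [(n * _)%N]mulnC !expnM -!expnMn.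
have B1 := expp_gt0 (t - v); have k1 := expp_gt0 (t - v - k).
apply: leq_mul; apply: leq_expn; first by move: (p ^ _)%N B1; lia.
case: (leqP k (t - v)) => kt; last first.
  have lt : (2 * p ^ (t - v) <= p ^ k)%N.
    apply: leq_trans (_ : p ^ (t - v).+1 <= _)%N; last by rewrite leq_exp2l ?prime_gt1.
    by rewrite expnS leq_mul2r prime_gt1 ?orbT.
  have := leq_div2r (p ^ k) lt; rewrite divnn expp_gt0 /=.
  by move: (_ %/ _)%N (p ^ (t - v - k))%N k1; lia.
rewrite -{1}(subnK kt) expnD mulnA mulnK ?expp_gt0 //.
by move: (p ^ _)%N k1; lia.
Qed.

(** A first moment bound. Sort the solutions by the power p^v that they
contain: the primitive part has height at most p^(t - v) and solves the
congruences modulo p^(g_i - v). Each primitive vector accounts for a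
proportion of at most p^(- sum (g_i - v - k)) of the class of A modulo p^k,
and [card_primitive_box] bounds how many of them can occur there. The terms
with v <= t - k form a geometric series; the last hypothesis makes the
remaining ones negligible. *)
Lemma card_has_short E k t (g : 'I_n -> nat) A : (0 < m)%N -> (k <= E)%N ->
  (forall i, t + k < g i)%N -> (forall i, g i <= E)%N ->
  (t.+1 * p ^ (k * (m + n)) <= p ^ t)%N ->
  (#|[pred X : resmx E | congmx p k (reprmx X) A &&
    has_short p t g (reprmx X)]| * p ^ (\sum_i g i)
   <= 3 ^ (m + n).+1 * (p ^ ((E - k) * (m * n)) * p ^ (t * (m + n))))%N.
Proof.
move=> m0 kE tg gE tbig.
pose Q v := [pred x : box (p ^ (t - v)) | [exists j, primitive p (boxZ x) j] &&
       solves p (fun=> k) (boxZ x) A].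
pose S v (x : box (p ^ (t - v))) :=
  [pred X : resmx E | congmx p k (reprmx X) A &&
    solves p (fun i => g i - v)%N (boxZ x) (reprmx X)].
pose c v := (\sum_(x | Q v x) #|S v x|)%N.
apply: leq_trans (_ : (\sum_(v < t.+1) c v) * p ^ (\sum_i g i) <= _)%N.
  rewrite leq_mul2r; apply/orP; right.
  apply: leq_trans (_ : \sum_(v < t.+1) #|[pred X | [exists x, Q v x && S v x X]]| <= _)%N.
    apply: card_union_le => X /andP[XA /has_shortP[a [a0 ah ag]]].
    have [v [a' [j [vt aE a'j a'h a'g]]]] :=
      primitive_decomposition p_pr a0 ah ag (fun i => leq_ltn_trans (leq_addr k t) (tg i)).
    exists (Ordinal (vt : (v < t.+1)%N)) => /=; apply/existsP.
    have [x xa] := boxZ_surj a'h; exists x.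
    rewrite /Q /S /= xa XA a'g !andbT; apply/andP; split.
      by apply/existsP; exists j.
    apply: (@solves_congmx_imp _ _ _ _ _ (reprmx X) _ k) => //.
    by apply: solves_le a'g => i; have := tg i; lia.
  apply: leq_sum => v _; apply: card_union_le => X /existsP[x xX].
  by exists x.
have cv (v : nat) : (v <= t)%N -> (c v * p ^ (\sum_i g i) <=
    3 ^ (m + n) * (p ^ ((E - k) * (m * n)) * p ^ ((t - v) * m + n * maxn t (v + k))))%N.
  move=> vt; have -> : (\sum_i g i = \sum_i (g i - v - k) + n * (v + k))%N.
    rewrite -[X in (X * _)%N]card_ord -sum_nat_const -big_split /=.
    by apply: eq_bigr => i _; have := tg i; lia.
  rewrite [(p ^ (_ + _))%N]expnD mulnA.
  apply: leq_trans (_ : #|Q v| * p ^ ((E - k) * (m * n)) * p ^ (n * (v + k)) <= _)%N.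
    rewrite leq_mul2r; apply/orP; right; rewrite /c big_distrl /= -sum_nat_const.
    apply: leq_sum => x /andP[/existsP[j xj] _]; apply: card_solutions_le xj => // i.
    by apply: leq_trans (gE i); rewrite leq_subr.
  have -> : ((t - v) * m + n * maxn t (v + k) =
      (t - v) * m + n * (t - v - k) + n * (v + k))%N.
    by rewrite -addnA -mulnDr; congr (_ + n * _)%N; lia.
  rewrite mulnAC [leqRHS]mulnA [leqRHS]mulnAC leq_mul2r; apply/orP; right.
  rewrite [(p ^ (_ + n * (v + k)))%N]expnD mulnA leq_mul2r; apply/orP; right.
  exact: card_primitive_box.
rewrite big_distrl /=.
apply: (@leq_trans (\sum_(v < t.+1) 3 ^ (m + n) *
    (p ^ ((E - k) * (m * n)) * p ^ ((t - v) * m + n * maxn t (v + k)))))%N.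
  by apply: leq_sum => v _; apply: cv; exact: ltn_ord v.
rewrite -big_distrr -big_distrr /= expnS [(3 * _)%N]mulnC -mulnA leq_mul2l; apply/orP;
  right.
rewrite [leqRHS]mulnCA leq_mul2l; apply/orP; right.
(* The first summand bounds the term for v + k <= t, the second one the term
for larger v, where the cells are coarser than the box. *)
apply: leq_trans (_ : \sum_(v < t.+1) (p ^ (t * n) * (p ^ m) ^ (t - v) +
    p ^ (k * (m + n)) * p ^ (t * n)) <= _)%N.
  apply: leq_sum => -[v /= vt] _; case: (leqP (v + k) t) => vk.
    apply: leq_trans (leq_addr _ _); rewrite -expnM -expnD leq_exp2l ?prime_gt1 //.
    by rewrite addnC [(n * _)%N]mulnC [(m * _)%N]mulnC.
  apply: leq_trans (leq_addl _ _); rewrite -expnD leq_exp2l ?prime_gt1 //.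
  have : ((t - v) * m <= k * m)%N by rewrite leq_mul2r; apply/orP; right; lia.
  have : (v * n <= t * n)%N by rewrite leq_mul2r; apply/orP; right; lia.
  lia.
rewrite big_split /= -big_distrr /= sum_nat_const card_ord.
apply: leq_trans (_ : p ^ (t * n) * (2 * (p ^ m) ^ t) + p ^ t * p ^ (t * n) <= _)%N.
  apply: leq_add; last by rewrite mulnA leq_mul2r tbig orbT.
  rewrite leq_mul2l sum_expn_le ?orbT //.
  by apply: leq_trans (prime_gt1 p_pr) _; rewrite -{1}[p]expn1 leq_exp2l ?prime_gt1.
rewrite mulnCA -expnM -!expnD addnC [(m * t)%N]mulnC -mulnDr [(n + m)%N]addnC.
have : (p ^ (t + t * n) <= p ^ (t * (m + n)))%N.
  rewrite leq_exp2l ?prime_gt1 // mulnDr leq_add2r -{1}[t]muln1 leq_mul2l.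
  by rewrite m0 orbT.
move: (p ^ _)%N (p ^ _)%N; lia.
Qed.

End Counting.

(** * Matrices close to a rational point and their distribution *)

Section Selection.
Variables (p m n : nat).
Hypothesis p_pr : prime p.
Implicit Types (X Y A : 'M[int]_(m, n)) (a : 'rV[int]_(m + n)) (k l E : nat).
Local Notation expp_gt0 := (expp_gt0 p_pr).
Local Notation expz_neq0 := (expz_neq0 p_pr).
Local Notation resmx := (resmx p m n).
Local Notation box := (box m n).

(** The matrices in the support of the measure attached to the scale h: g are
the exponents of Dirichlet's theorem and e the full ones, while b measures
what counts as a short vector. *)
Definition selected (b h : nat) (g e : 'I_n -> nat) X : bool :=
  ~~ has_short p (h - b) g X && has_primitive p h e X.

Lemma solves_rowshift g t j a X :
  solves p g a (X + rowshift p g t j) = solves p g a X.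
Proof.
apply/solvesP/solvesP => h i; have := h i; rewrite zform_rowshift => hi.
  by rewrite -(addrK (lsubmx a 0 j * (t i * p ^ g i)%N) (zform a X 0 i)) rpredB //
     PoszM mulrA dvdz_mull.
by rewrite rpredD // PoszM mulrA dvdz_mull.
Qed.

(** A Bezout relation between p^(e_i - g_i) and a_0(j) gives the right
translation in column i. *)
Lemma lift_solution g e a j X : (forall i, g i <= e i)%N -> primitive p a j ->
  solves p g a X -> exists2 t : 'I_n -> nat, (forall i, t i < p ^ (e i - g i))%N &
  solves p e a (X + rowshift p g t j).
Proof.
move=> ge aj /solvesP ag.
have ex i : exists t : nat, (t < p ^ (e i - g i))%N /\
    ((p ^ e i)%N%:Z %| zform a X 0%R i + lsubmx a 0%R j * (t * p ^ g i)%N%:Z)%Z.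
  have [u [v uv]] := Bezoutz (p ^ (e i - g i))%N%:Z (lsubmx a 0 j).
  have cop : gcdz (p ^ (e i - g i))%N%:Z (lsubmx a 0 j) = 1.
    apply/eqP; rewrite -[_ == _]/(coprimez _ _).
    by rewrite coprimezE /= coprimeXl // prime_coprime.
  rewrite cop in uv.
  have /dvdzP[r rE] := ag i.
  exists `|((- r * v) %% (p ^ (e i - g i))%N%:Z)%Z|%N; split.
    by rewrite -ltz_nat gez0_abs ?modz_ge0 ?ltz_mod ?expz_neq0.
  rewrite PoszM gez0_abs ?modz_ge0 ?expz_neq0 // rE.
  have -> : (p ^ e i)%N%:Z = (p ^ (e i - g i))%N%:Z * (p ^ g i)%N%:Z :> int.
    by rewrite -PoszM -expnD subnK.
  rewrite mulrA -mulrDl dvdz_mul2r ?expz_neq0 //.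
  have := divz_eq (- r * v) (p ^ (e i - g i))%N%:Z.
  set q := (_ %/ _)%Z; set s := (_ %% _)%Z => rv.
  have -> : s = - r * v - q * (p ^ (e i - g i))%N%:Z by rewrite rv addrC addKr.
  have -> : r + lsubmx a 0 j * (- r * v - q * (p ^ (e i - g i))%N%:Z) =
     r * (1 - v * lsubmx a 0 j) - lsubmx a 0 j * q * (p ^ (e i - g i))%N%:Z by ring.
  rewrite -uv addrK rpredB // ?dvdz_mull //.
have [t tP] := choice ex; exists t; first by move=> i; case: (tP i).
by apply/solvesP => i; rewrite zform_rowshift; case: (tP i).
Qed.

(** Every good X is carried to a selected one by a translation in some row j
by multiples of p^(g_i), and these translations preserve both goodness and the
class of A. As X can be recovered from its image, the translation and j, the
number of good X is at most the number of selected matrices times that of the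
pairs formed by j and a translation. *)
Lemma card_selected_ge E k b h g e A : (forall i, k <= g i)%N ->
  (forall i, g i <= e i)%N -> (forall i, e i <= E)%N -> (k <= E)%N ->
  (#|[pred X : resmx E | congmx p k (reprmx X) A &&
       (~~ has_short p (h - b) g (reprmx X) && has_primitive p h g (reprmx X))]|
   <= m * p ^ (\sum_i (e i - g i)) *
      #|[pred X : resmx E | congmx p k (reprmx X) A && selected b h g e (reprmx X)]|)%N.
Proof.
move=> kg ge eE kE; set D := [pred X | _]; set D' := [pred X | _ && selected _ _ _ _ _].
pose T := {dffun forall i : 'I_n, 'I_(p ^ (e i - g i)).-1.+1}.
have cT : #|{: T}| = (p ^ (\sum_i (e i - g i)))%N.
  rewrite (card_dffun_ord (fun i => p ^ (e i - g i))%N) expn_sum.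
  by apply: eq_bigr => i _; rewrite prednK ?expp_gt0.
have -> : (m * p ^ (\sum_i (e i - g i)) = #|{: 'I_m *
  T}|)%N by rewrite card_prod card_ord cT.
rewrite -cardX.
pose f (u : ('I_m * T) * resmx E) : resmx E :=
  redmx p E (reprmx u.2 - rowshift p g (fun i => u.1.2 i) u.1.1).
apply: leq_trans (leq_imset_card f _); apply: subset_leq_card.
apply/fintype.subsetP => X /andP[XA /andP[Xb /has_primitiveP[a [j [aj ah ag]]]]].
have [t tlt te] := lift_solution ge aj ag.
pose t' : T := [ffun i => inord (t i)].
have t'E i : nat_of_ord (t' i) = t i.
  by rewrite ffunE inordK // prednK ?expp_gt0.
pose X' := redmx p E (reprmx X + rowshift p g t j).
have XX' : congmx p E (reprmx X') (reprmx X + rowshift p g t j) by exact: reprmx_redmx.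
have rs : rowshift p g (fun i => t' i) j = rowshift p g t j.
  by apply/matrixP => i i'; rewrite !mxE t'E.
apply/imsetP; exists ((j, t'), X'); last first.
  rewrite /f /= rs -[LHS](reprmxK p_pr); apply: redmx_eq; apply/congmxP => i i'.
  have := congmxP _ _ _ _ XX' i i'; rewrite -rpredN.
  suff -> : reprmx X i i' - (reprmx X' - rowshift p g t j) i i' = - (reprmx X' i i' - (reprmx X + rowshift p g t j) i i') by [].
  by rewrite !mxE; ring.
rewrite inE /= inE; apply/andP; split.
  apply: congmx_trans (congmx_le kE XX') _; apply: congmx_trans XA.
  exact: rowshift_congmx.
have gE i : (g i <= E)%N by exact: leq_trans (eE i).
apply/andP; split.
  apply: contra Xb => /existsP[x /andP[x0 xg]]; apply/existsP; exists x.
  by rewrite x0 /= -(solves_rowshift _ t j) -(solves_congmx _ gE XX').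
by apply/has_primitiveP; exists a, j; split=> //; rewrite (solves_congmx _ eE XX').
Qed.

(** Fix one selected matrix X0 in the ball. The vectors a attached to the
selected matrices of the ball solve the system for X0 modulo p^(min (l, e_i)).
Two such vectors whose errors for X0 agree modulo p^(g_i) differ by a solution
modulo p^(g_i), hence by a vector that is not short; so [packing] bounds their
number, and [card_solutions_le] bounds the number of matrices attached to each
of them. *)
Lemma card_selected_le E l b h g e A : (b <= h)%N ->
  (forall i, e i <= E)%N -> (l <= E)%N ->
  (#|[pred X : resmx E | congmx p l (reprmx X) A && selected b h g e (reprmx X)]|
     * p ^ (\sum_i (e i - l))
   <= (3 * p ^ b) ^ (m + n) * p ^ (\sum_i (g i - minn l (e i)))
      * p ^ ((E - l) * (m * n)))%N.
Proof.
move=> bh eE lE; set D := [pred X | _].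
have [X0 X0D|D0] := pickP D; last by rewrite (eq_card0 D0).
have /andP[X0A /andP[/negP X0g _]] := X0D.
pose e' i := minn l (e i).
pose P := [pred x : box (p ^ h) | [exists j, primitive p (boxZ x) j] &&
  solves p e' (boxZ x) (reprmx X0)].
have cP : (#|P| <= (3 * p ^ b) ^ (m + n) * p ^ (\sum_i (g i - e' i)))%N.
  pose T := {dffun forall i : 'I_n, 'I_(p ^ (g i - e' i)).-1.+1}.
  have <- : #|{: T}| = (p ^ (\sum_i (g i - e' i)))%N.
    rewrite (card_dffun_ord (fun i => p ^ (g i - e' i))%N) expn_sum.
    by apply: eq_bigr => i _; rewrite prednK ?expp_gt0.
  pose lb (x : box (p ^ h)) : T := [ffun i =>
    residue p (g i - e' i) (zform (boxZ x) (reprmx X0) 0%R i %/ (p ^ e' i)%N%:Z)%Z].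
  have := @packing m n (p ^ h) T lb P (fun=> (p ^ (h - b))%N) (fun=> expp_gt0 _).
  rewrite prod_nat_const card_ord => packP.
  rewrite [leqRHS]mulnC; apply: leq_trans (packP _) _ => {packP}; last first.
    rewrite leq_mul2l; apply/orP; right; apply: leq_expn.
    rewrite -{1}(subnKC bh) expnD mulnA mulnK ?expp_gt0 //.
    by have := expp_gt0 b; lia.
  move=> x y /andP[_ /solvesP xe] /andP[_ /solvesP ye] /ffunP lxy xy.
  apply/eqP; rewrite -(inj_eq (@boxZ_inj _ _ _)) -subr_eq0; apply/negPn/negP => xy0.
  apply: X0g; apply/has_shortP; exists (boxZ x - boxZ y); split=> //.
    by move=> c; rewrite !mxE; have := xy c; rewrite !mxE; lia.
  apply/solvesP => i; have -> : zform (boxZ x - boxZ y) (reprmx X0) 0 i =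
      zform (boxZ x) (reprmx X0) 0 i - zform (boxZ y) (reprmx X0) 0 i.
    by rewrite zformB; set u := zform _ _; set v := zform _ _; rewrite !mxE.
  have := lxy i; rewrite !ffunE => /(residue_eq p_pr) dq.
  apply: (@dvdz_pexp_le _ _ (g i - e' i + e' i)); first by lia.
  rewrite -(divzK (xe i)) -(divzK (ye i)) -mulrBl expnD PoszM dvdz_mul //.
pose S (x : box (p ^ h)) := [pred X : resmx E | congmx p l (reprmx X) A &&
  solves p e (boxZ x) (reprmx X)].
have DS : (#|D| <= \sum_(x | P x) #|S x|)%N.
  apply: card_union_le => X /andP[XA /andP[_ /has_primitiveP[a [j [aj ah ae]]]]].
  have [x xa] := boxZ_surj ah; exists x; rewrite /P /S /= unfold_in xa XA ae !andbT.
  apply/andP; split; first by apply/existsP; exists j.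
  apply: (@solves_congmx_imp _ _ _ _ _ (reprmx X) _ l) => [i||].
  - exact: geq_minl.
  - by apply: congmx_trans XA _; rewrite congmx_sym.
  - by apply: solves_le ae => i; exact: geq_minr.
apply: leq_trans (_ : #|P| * p ^ ((E - l) * (m * n)) <= _)%N;
  last by rewrite leq_mul2r cP orbT.
apply: leq_trans (_ : (\sum_(x | P x) #|S x|) * p ^ (\sum_i (e i - l)) <= _)%N.
  by rewrite leq_mul2r DS orbT.
rewrite big_distrl /= -sum_nat_const; apply: leq_sum => x /andP[/existsP[j xj] _].
exact: card_solutions_le xj.
Qed.

End Selection.

(** A constant b for which [card_has_short], applied with t = h - b, loses at
most half of the matrices. It is independent of the scale and of the ball. *)
Definition slack (p m n : nat) := (2 * 3 ^ (m + n).+1 * p ^ n)%N.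

Section CutOff.
Variables (b n : nat) (e : 'I_n -> nat) (U : nat).

(** The exponents of the theorem of Dirichlet, lowered by b to make room for
the division by a power of p in [good_has_primitive]. *)
Definition cutoff i := (minn (e i) U - b)%N.
Local Notation g := cutoff.

(** Raising U by one increases the sum of the min (e_i, U) by at most n. *)
Lemma sum_cutoff N : (forall i, b < minn (e i) U)%N ->
  (N < \sum_i minn (e i) U.+1)%N -> (N <= \sum_i g i + n * b + n)%N.
Proof.
move=> min_gt U_gt; have -> : (\sum_i g i + n * b + n = \sum_i (minn (e i) U).+1)%N.
  rewrite -[X in (X * b)%N]card_ord -sum_nat_const -[X in (_ + X)%N]card_ord.
  rewrite -sum1_card -!big_split /=; apply: eq_bigr => i _.
  by rewrite /g; have := min_gt i; lia.
by apply: ltnW; apply: leq_trans U_gt _; apply: leq_sum => i _; lia.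
Qed.

(** The exponent that governs the mass of a ball of radius p^(-l): up to a
constant, the selected matrices make up at most a proportion p^(spread l - sum
e_i) of it. *)
Definition spread l := (\sum_i maxn (minn l (e i)) (g i))%N.

Lemma spread_small l : (l <= U)%N -> (spread l <= \sum_i minn (e i) U)%N.
Proof. by move=> lU; apply: leq_sum => i _; rewrite /g; lia. Qed.

Lemma spread_large l : (U <= l)%N -> spread l = (\sum_i minn l (e i))%N.
Proof. by move=> lU; apply: eq_bigr => i _; rewrite /g; lia. Qed.

End CutOff.

Section ScaleNat.
Variables (p m n : nat).
Hypothesis p_pr : prime p.
Hypothesis m_gt0 : (0 < m)%N.
Implicit Types (X Y A : 'M[int]_(m, n)) (a : 'rV[int]_(m + n)) (k l E h U : nat).
Implicit Types e : 'I_n -> nat.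
Local Notation expp_gt0 := (expp_gt0 p_pr).
Local Notation resmx := (resmx p m n).
Local Notation b := (slack p m n).
Local Notation g := (cutoff b).

(** The first two conditions say that sum_i min (e_i, U) is h (m + n) up to n,
so that the hypothesis of Dirichlet's theorem is met with almost equality; the
others say that h is large in terms of the level k of the balls under
consideration. *)
Definition admissible_scale k h U e :=
  [/\ (\sum_i minn (e i) U <= h * (m + n))%N,
      (h * (m + n) < \sum_i minn (e i) U.+1)%N,
      (forall i, h + k < minn (e i) U)%N,
      (b <= h)%N &
      ((h - b).+1 * p ^ (k * (m + n)) <= p ^ (h - b))%N].

(** The choice of the slack: the exponent (h - b) (m + n) - sum g_i of
[card_has_short] is at most n - b m. *)
Lemma card_has_short_half E k h U e A :
  admissible_scale k h U e -> (forall i, e i <= E)%N -> (k <= E)%N ->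
  (2 * #|[pred X : resmx E | congmx p k (reprmx X) A &&
    has_short p (h - b) (g e U) (reprmx X)]|
   <= p ^ ((E - k) * (m * n)))%N.
Proof.
move=> [U_le U_gt min_gt bh h_big] eE kE.
have gE i : (g e U i <= E)%N by apply: leq_trans (eE i); rewrite /cutoff; lia.
have tg i : (h - b + k < g e U i)%N by rewrite /cutoff; have := min_gt i; lia.
have := card_has_short p_pr A m_gt0 kE tg gE h_big; set B := #|_|%N.
set V := (p ^ ((E - k) * _))%N => hB.
have min_b i : (b < minn (e i) U)%N by have := min_gt i; lia.
have e1 : (p ^ ((h - b) * (m + n)) * p ^ (b * m) <= p ^ n * p ^ (\sum_i g e U i))%N.
  rewrite -!expnD leq_exp2l ?prime_gt1 // mulnBl.
  have := @sum_cutoff b n e U _ min_b U_gt;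
    have : (b * (m + n) <= h * (m + n))%N by rewrite leq_mul2r bh orbT.
  by rewrite [(b * (m + n))%N]mulnDr [(b * n)%N]mulnC; lia.
have bm : (b <= p ^ (b * m))%N.
  apply: leq_trans (_ : p ^ b <= _)%N; first by rewrite ltnW // ltn_expl ?prime_gt1.
  by rewrite leq_exp2l ?prime_gt1 // leq_pmulr.
have g0 := expp_gt0 (\sum_i g e U i).
rewrite -(leq_pmul2r g0) -(@leq_pmul2r (3 ^ (m + n).+1 * p ^ n)); last first.
  by rewrite muln_gt0 expp_gt0 expn_gt0.
apply: leq_trans (_ : b * (B * p ^ (\sum_i g e U i)) <= _)%N.
  by rewrite /slack; apply: eq_leq; ring.
apply: leq_trans (_ : p ^ (b * m) * (3 ^ (m + n).+1 * (V * p ^ ((h - b) * (m + n)))) <=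
  _)%N.
  exact: leq_mul.
have -> : (p ^ (b * m) * (3 ^ (m + n).+1 * (V * p ^ ((h - b) * (m + n)))) =
  3 ^ (m + n).+1 * V * (p ^ ((h - b) * (m + n)) * p ^ (b * m)))%N by ring.
apply: leq_trans (leq_mul (leqnn _) e1) _.
by apply: eq_leq; ring.
Qed.

Lemma card_selected_lower E k h U e A :
  admissible_scale k h U e -> (forall i, e i <= E)%N -> (k <= E)%N ->
  (p ^ ((E - k) * (m * n)) <= 2 * m * p ^ (\sum_i (e i - g e U i)) *
    #|[pred X : resmx E | congmx p k (reprmx X) A &&
      selected p b h (g e U) e (reprmx X)]|)%N.
Proof.
move=> ok eE kE; have [U_le U_gt min_gt bh h_big] := ok.
have kg i : (k <= g e U i)%N by rewrite /cutoff; have := min_gt i; lia.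
have ge i : (g e U i <= e i)%N by rewrite /cutoff; lia.
have := card_selected_ge p_pr b h A kg ge eE kE.
set S := #|[pred X : resmx E | _ && selected _ _ _ _ _ _]|; set G := #|_| => GS.
have -> : (2 * m * p ^ (\sum_i (e i - g e U i)) * S = 2 * (m *
  p ^ (\sum_i (e i - g e U i)) * S))%N.
  by rewrite !mulnA.
apply: leq_trans (leq_mul (leqnn 2) GS).
have := card_has_short_half A ok eE kE; set B := #|_|%N; set V := (p ^ _)%N => BV.
suff : (V <= B + G)%N by lia.
rewrite /V -(card_class p_pr A kE) -(cardID [pred X :
  resmx E | has_short p (h - b) (g e U) (reprmx X)]).
apply: leq_add; apply: subset_leq_card; apply/fintype.subsetP => X; rewrite !inE.
  by move=> /andP[-> ->].
move=> /andP[Xb ->]; rewrite Xb /=; apply: good_has_primitive Xb => //.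
- by move=> i; rewrite /cutoff; have := min_gt i; lia.
- by move=> i; rewrite /cutoff; have := min_gt i; lia.
apply: leq_trans U_le; apply: leq_sum => i _.
by rewrite /cutoff; have := min_gt i; lia.
Qed.

Lemma card_selected_upper E l h U e A :
  (b <= h)%N -> (forall i, e i <= E)%N -> (l <= E)%N ->
  (#|[pred X : resmx E | congmx p l (reprmx X) A && selected p b h (g e U) e (reprmx X)]|
     * p ^ (\sum_i e i) * p ^ (l * (m * n))
   <= (3 * p ^ b) ^ (m + n) * p ^ spread b e U l * p ^ (E * (m * n)))%N.
Proof.
move=> bh eE lE; have := card_selected_le p_pr (g e U) A bh eE lE; set S := #|_| => hS.
have -> : (\sum_i e i = \sum_i (e i - l) + \sum_i minn l (e i))%N.
  by rewrite -big_split; apply: eq_bigr => i _ /=; move: (e i) => u; clear; lia.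
have -> : spread b e U l = (\sum_i (g e U i - minn l (e i)) + \sum_i minn l (e i))%N.
  by rewrite -big_split; apply: eq_bigr => i _ /=; move: (cutoff b e U i) (e i) => u v;
    clear; lia.
have -> : (E * (m * n) = (E - l) * (m * n) + l * (m * n))%N.
  by rewrite -mulnDl subnK.
rewrite !(expnD p).
apply: leq_trans (_ : (S * p ^ (\sum_i (e i - l))) *
  (p ^ (\sum_i minn l (e i)) * p ^ (l * (m * n))) <= _)%N.
  by apply: eq_leq; ring.
apply: leq_trans (leq_mul hS (leqnn _)) _.
by apply: eq_leq; ring.
Qed.

Lemma selected_height b' h e e' X : (forall i, e' i <= e i)%N ->
  selected p b' h e' e X -> exists a, [/\ a != 0, height_le a (p ^ h),
  (p ^ (h - b') < int_height a)%N & solves p e a X].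
Proof.
move=> ee /andP[/negP Xb /has_primitiveP[a [j [aj ah ae]]]].
have a0 : a != 0.
  by apply: contraNneq aj => ->; rewrite !mxE dvdz0.
exists a; split=> //; rewrite ltnNge; apply/negP => hle_a; apply: Xb.
apply/has_shortP; exists a; split=> //.
  by move=> c; move/bigmax_leqP: hle_a; apply.
exact: solves_le ae.
Qed.

End ScaleNat.

(** * The measure attached to one scale *)

Section CylinderWeight.
Variables (R : realType) (p : nat).
Hypothesis p_pr : prime p.

(** The r-th power of the radius p^(-l) of a class modulo p^l. *)
Definition cweight (r : R) (l : nat) : R := p%:R `^ (- (l%:R * r)).

Let p0 : 0 < p%:R :> R. Proof. by rewrite ltr0n prime_gt0. Qed.
Let p1 : 1 <= p%:R :> R. Proof. by rewrite ler1n prime_gt0. Qed.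

Lemma ppowD (x y : R) : p%:R `^ (x + y) = p%:R `^ x * p%:R `^ y :> R.
Proof. by rewrite powRD //; apply/implyP => _; rewrite gt_eqF. Qed.

Lemma ppow_nat (k : nat) : (p ^ k)%N%:R = p%:R `^ k%:R :> R.
Proof. by rewrite natrX powR_mulrn // ltW. Qed.

Lemma ppow_lt (x y : R) : x < y -> p%:R `^ x < p%:R `^ y :> R.
Proof.
by move=> xy; rewrite /powR !gt_eqF // ltr_expR ltr_pM2r // ln_gt0 // ltr1n prime_gt1.
Qed.

Lemma ppow_le (x y : R) : x <= y -> p%:R `^ x <= p%:R `^ y :> R.
Proof. exact: ler_powR. Qed.

Lemma cweight_gt0 r l : 0 < cweight r l. Proof. exact: powR_gt0. Qed.

Lemma cweight_add r l l' : cweight r (l + l') = cweight r l * cweight r l'.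
Proof. by rewrite /cweight natrD mulrDl opprD ppowD. Qed.

Lemma cweightD r r' l : cweight (r + r') l = cweight r l * cweight r' l.
Proof. by rewrite /cweight mulrDr opprD ppowD. Qed.

Lemma cweight0 r : cweight r 0 = 1.
Proof. by rewrite /cweight mul0r oppr0 powRr0. Qed.

Lemma cweight_le1 r l : 0 <= r -> cweight r l <= 1.
Proof.
by move=> r0; rewrite -(powRr0 p%:R) ler_powR // oppr_le0 mulr_ge0.
Qed.

Lemma cweight_le r l l' : 0 <= r -> (l <= l')%N -> cweight r l' <= cweight r l.
Proof.
move=> r0 ll; rewrite -(subnKC ll) cweight_add ler_piMr ?cweight_le1 //.
exact/ltW/cweight_gt0.
Qed.

Lemma cweightX r l : cweight r l = (cweight r 1) ^+ l.
Proof. by elim: l => [|l IH];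
  rewrite ?cweight0 // -[in LHS]addn1 cweight_add IH exprSr. Qed.

Lemma cweight_small r (e : R) : 0 < r -> 0 < e -> exists q, cweight r q <= e.
Proof.
move=> r0 e0.
have c1 : cweight r 1 < 1.
  by rewrite -(powRr0 p%:R); apply: ppow_lt; rewrite mul1r oppr_lt0.
have : ((cweight r 1) ^+ q @[q --> \oo] --> (0 : R))%classic.
  by apply: cvg_expr; rewrite ger0_norm // ltW ?cweight_gt0.
move=> /cvgr_le /(_ e e0) [q _ /(_ q (leqnn q)) /= h].
by exists q; rewrite cweightX.
Qed.

Lemma cweight_nat (d l : nat) : cweight d%:R l = ((p ^ (l * d))%N%:R)^-1.
Proof. by rewrite /cweight powRN ppow_nat natrM. Qed.

End CylinderWeight.

(** All points of the ball of radius p^(-E) around X are approximated by one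
vector of height above N. *)
Definition witness (R : realType) (p m n : nat) (tau : 'I_n -> R) N E
    (X : 'M[int]_(m, n)) :=
  exists a e, [/\ forall i, (e i <= E)%N, (N < int_height a)%N, solves p e a X &
    forall i, (p ^ e i)%N%:R^-1 < (int_height a)%:R `^ (- tau i)].

Lemma witness_le (R : realType) (p m n : nat) (tau : 'I_n -> R) N N' E
    (X : 'M[int]_(m, n)) : (N <= N')%N ->
  witness p tau N' E X -> witness p tau N E X.
Proof.
by move=> NN [a [e [eE aN ae h]]]; exists a, e; split=> //; exact: leq_ltn_trans aN.
Qed.

Section ScaleReal.
Variables (R : realType) (p m n : nat) (tau : 'I_n -> R) (s : R).
Hypothesis p_pr : prime p.
Hypothesis m_gt0 : (0 < m)%N.
Hypothesis n_gt0 : (0 < n)%N.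
Hypothesis tau_gt1 : forall i, 1 < tau i.
Hypothesis tau_sum : (m + n)%:R < \sum_(i < n) tau i.
Let d : R := (m * n)%:R.
Hypothesis s_lt : s < d.
Hypothesis s_opt : forall x : R, 0 < x ->
  \sum_(i < n) Num.min x (tau i) - (m + n)%:R <= x * (d - s).
Local Notation b := (slack p m n).
Local Notation resmx := (resmx p m n).

(** The smallest exponents for which p^(- level) < p^(- h tau_i), which is
what a vector of height at most p^h needs. *)
Definition level (h : nat) (i : 'I_n) : nat := (Num.truncn (h%:R * tau i)).+1.

Let tau_gt0 i : 0 < tau i. Proof. exact: lt_trans (tau_gt1 i). Qed.

Lemma level_gt h i : h%:R * tau i < (level h i)%:R.
Proof. exact: truncnS_gt. Qed.

Lemma level_le h i : (level h i)%:R <= h%:R * tau i + 1.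
Proof.
rewrite /level -addn1 natrD lerD2r.
by have /andP[] := truncn_itv (mulr_ge0 (ler0n R h) (ltW (tau_gt0 i))).
Qed.

Lemma sum_level_gt h : (0 < h)%N -> (h * (m + n) < \sum_i level h i)%N.
Proof.
move=> h0; rewrite -(ltr_nat R) natrM natr_sum.
apply: lt_trans (_ : h%:R * \sum_i tau i < _); first by rewrite ltr_pM2l ?ltr0n.
rewrite big_distrr /=; apply: ltr_sum => [|i _]; last exact: level_gt.
by apply/hasP; exists (Ordinal n_gt0); rewrite ?mem_index_enum.
Qed.

(** U is the largest integer with sum_i min (level_i, U) <= h (m + n); it
exists because the sum of the tau_i exceeds m + n. *)
Lemma exists_cutoff h : (0 < h)%N -> exists U,
  [/\ (\sum_i minn (level h i) U <= h * (m + n))%N,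
      (h * (m + n) < \sum_i minn (level h i) U.+1)%N &
      (U <= \max_i level h i)%N].
Proof.
move=> h0; pose P U := (\sum_i minn (level h i) U <= h * (m + n))%N.
have P0 : exists U, P U.
  by exists 0%N; rewrite /P big1 // => i _; rewrite minn0.
have Pub U : P U -> (U <= \max_i level h i)%N.
  apply: contraTT; rewrite -!ltnNge => lU.
  apply: leq_trans (sum_level_gt h0) _; apply: leq_sum => i _.
  rewrite leq_min leqnn (leq_trans _ (ltnW lU)) //.
  exact: (@leq_bigmax _ (level h)).
case: (ex_maxnP P0 Pub) => U PU Umax; exists U; split=> //; last exact: Pub.
by rewrite ltnNge; apply/negP => /Umax; rewrite ltnn.
Qed.

Lemma expn_dominates K t : (2 * K + 2 <= t)%N -> (t.+1 * p ^ K <= p ^ t)%N.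
Proof.
move=> tK; have -> : t = (K + (t - K - 1).+1)%N by lia.
rewrite expnD mulnC leq_mul2l; apply/orP; right.
apply: leq_trans (_ : 2 ^ (t - K - 1).+1 <= _)%N; last first.
  by apply: leq_expn; exact: prime_gt1.
have := ltn_expl (t - K - 1) (isT : 1 < 2)%N; rewrite expnS.
by move: (2 ^ _)%N => x; lia.
Qed.

Lemma exists_scale k N : exists h U, [/\ admissible_scale p m k h U (level h),
  (U <= \max_i level h i)%N, (b + N <= h)%N & (0 < h)%N].
Proof.
pose K := (k * (m + n))%N.
pose T := (\sum_i (Num.truncn (k%:R / (tau i - 1))).+1)%N.
pose h := (b + N + n * k.+1 + (2 * K + 2) + T)%N.
have h0 : (0 < h)%N by rewrite /h; lia.
have [U [U1 U2 U3]] := exists_cutoff h0; exists h, U; split=> //; last by rewrite /h; lia.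
split=> //; last by apply: expn_dominates; rewrite /h; lia.
  2: by rewrite /h; lia.
move=> i; rewrite leq_min; apply/andP; split.
  rewrite -(ltr_nat R); apply: le_lt_trans (level_gt h i).
  rewrite natrD -lerBrDl -{2}[h%:R]mulr1 -mulrBr -ler_pdivrMr ?subr_gt0 //.
  apply: ltW; apply: lt_le_trans (truncnS_gt _) _; rewrite ler_nat /h.
  by apply: leq_trans (leq_addl _ _); rewrite /T (bigD1 i) //= leq_addr.
rewrite ltnNge; apply/negP => Uhk.
have : (h * (m + n) < n * (h + k).+1)%N.
  apply: leq_trans U2 _; rewrite -[X in (X * _)%N]card_ord -sum_nat_const.
  by apply: leq_sum => j _; lia.
have : (n * k.+1 < h)%N by rewrite /h; lia.
have : (h <= h * m)%N by rewrite leq_pmulr.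
rewrite !mulnDr !mulnS mulnDr [(h * n)%N]mulnC; lia.
Qed.

(** The place where the critical exponent enters: [s_opt] at x = l / h,
multiplied by h. *)
Lemma sum_min_level_le h l : (0 < h)%N -> (0 < l)%N ->
  (\sum_i minn l (level h i))%:R <= n%:R + (h * (m + n))%:R + l%:R * (d - s).
Proof.
move=> h0 l0; have h0' : 0 < h%:R :> R by rewrite ltr0n.
rewrite natr_sum.
have : \sum_i (minn l (level h i))%:R <=
  \sum_(i < n) (1 + h%:R * Num.min (l%:R / h%:R) (tau i)) :> R.
  apply: ler_sum => i _; rewrite (minr_pMr _ _ (ltW h0')) mulrCA divff ?gt_eqF // mulr1.
  rewrite -lerBlDl le_min !lerBlDl; apply/andP; split.
    by rewrite -(natrD _ 1%N) ler_nat; lia.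
  by rewrite addrC; apply: le_trans (level_le h i); rewrite ler_nat geq_minr.
move/le_trans; apply; rewrite big_split /= sumr_const card_ord -mulr_natl mulr1.
rewrite -big_distrr /= -addrA lerD2l natrM -lerBlDl -mulrBr.
apply: le_trans (_ : h%:R * (l%:R / h%:R * (d - s)) <= _).
  by rewrite ler_pM2l //; apply: s_opt; rewrite divr_gt0 ?ltr0n.
by rewrite mulrA mulrCA divff ?mulr1 // gt_eqF.
Qed.

Lemma sum_indicator_mass E (W : R) (P : pred (resmx E)) (Q : pred (resmx E)) :
  \sum_(X : resmx E | P X) (W * (Q X)%:R) = W * #|[pred X | P X && Q X]|%:R.
Proof.
rewrite -big_distrr /= -sum1_card natr_sum [in RHS]big_mkcondr /=; congr (_ * _).
by apply: eq_bigr => X _; case: (Q X).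
Qed.

(** The measure of a set is the proportion of selected matrices in it, divided
by p^(h (m + n) - sum e_i), which is the order of the density of the selected
matrices. At radii of at least p^(-N) it is dominated by Haar measure; at all
radii the bound with exponent s holds, and it improves at radii smaller than
p^(-l1), where the measure is uniform. *)
Theorem scale_measure : exists C c : R, [/\ 0 < C, 0 < c &
  forall k N : nat, exists l1 : nat, (k <= l1)%N /\ (N <= l1)%N /\
  forall E, (l1 <= E)%N -> exists nu : resmx E -> R,
  [/\ forall X, 0 <= nu X,
     forall A, c * cweight p d k <= \sum_(X | congmx p k (reprmx X) A) nu X,
     forall A l, (l <= N)%N ->
       \sum_(X | congmx p l (reprmx X) A) nu X <= C * cweight p d l,
     forall A l, (l <= E)%N -> \sum_(X | congmx p l (reprmx X) A) nu X
        <= C * cweight p s l * cweight p (d - s) (l - l1) &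
     forall X, 0 < nu X -> witness p tau N E (reprmx X)]].
Proof.
pose C0 := ((3 * p ^ b) ^ (m + n))%N.
pose C : R := (C0 * p ^ n)%N%:R.
pose c : R := (2 * m * p ^ (n * b + n))%N%:R^-1.
have pn0 k : 0 < (p ^ k)%N%:R :> R by rewrite ltr0n expn_gt0 prime_gt0.
have C00 : (0 < C0)%N by rewrite /C0 expn_gt0 muln_gt0 (expp_gt0 p_pr).
exists C, c; split.
- by rewrite /C natrM mulr_gt0 ?pn0 ?ltr0n.
- by rewrite /c invr_gt0 natrM mulr_gt0 ?pn0 ?ltr0n ?muln_gt0.
move=> k N.
have [h [U [ok U3 bh h0]]] := exists_scale k N.
have [U1 U2 U4 bh' _] := ok.
pose e := level h; pose l1 := (\max_i e i)%N.
have hl1 : (h + k < l1)%N.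
  apply: leq_trans (U4 (Ordinal n_gt0)) _; apply: leq_trans (geq_minl _ _) _.
  exact: (@leq_bigmax _ e).
exists l1; do 2! [split; first lia]; move=> E l1E.
have eE i : (e i <= E)%N by apply: leq_trans l1E; exact: (@leq_bigmax _ e).
have kE : (k <= E)%N by lia.
pose W : R := (p ^ (\sum_i e i))%N%:R / ((p ^ (h * (m + n)))%N%:R * (p ^ (E * (m *
  n)))%N%:R).
have W0 : 0 < W by rewrite divr_gt0 ?mulr_gt0.
pose g := cutoff b e U.
pose S (X : 'M[int]_(m, n)) := selected p b h g e X.
exists (fun X : resmx E => W * (S (reprmx X))%:R).
(* [spread] turns all upper bounds into estimates of one exponent. *)
have upper A l : (l <= E)%N -> 
  \sum_(X : resmx E | congmx p l (reprmx X) A) W * (S (reprmx X))%:R <=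
    C0%:R * ((p ^ spread b e U l)%N%:R / (p ^ (h * (m + n)))%N%:R) * cweight p d l.
  move=> lE; rewrite sum_indicator_mass //.
  have := card_selected_upper p_pr U A bh' eE lE.
  rewrite -(ler_nat R) !natrM.
  set V := #|_|%:R => hV.
  rewrite /W cweight_nat // -(ler_pM2r (pn0 (l * (m * n))%N)) mulfVK ?gt_eqF //.
  rewrite -(ler_pM2r (pn0 (h * (m + n))%N)) -(ler_pM2r (pn0 (E * (m * n))%N)).
  set x := (p ^ (\sum_i _))%N%:R in hV *; set y := (p ^ (h * _))%N%:R.
  set z := (p ^ (E * _))%N%:R in hV *.
  set t := (p ^ (l * _))%N%:R in hV *; set u := (p ^ _)%N%:R in hV *.
  have y0 : y != 0 by rewrite gt_eqF // /y pn0.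
  have z0 : z != 0 by rewrite gt_eqF // /z pn0.
  have -> : x / (y * z) * V * t * y * z = V * x * t by field; rewrite y0 z0.
  by have -> : C0%:R * (u / y) * y * z = C0%:R * u * z by field.
have small l : (l <= U)%N -> (p ^ spread b e U l)%N%:R / (p ^ (h * (m + n)))%N%:R <= 1 :> R.
  move=> lU; rewrite ler_pdivrMr // mul1r ler_nat leq_exp2l ?prime_gt1 //.
  exact: leq_trans (spread_small _ _ lU) U1.
have C0C : C0%:R <= C.
  by rewrite /C natrM ler_peMr ?ler0n // ler1n expn_gt0 prime_gt0.
have ds0 : 0 <= d - s by rewrite subr_ge0 ltW.
have cwd l : cweight p d l = cweight p s l * cweight p (d - s) l.
  by rewrite -cweightD // addrC subrK.
have cw0' r l : 0 <= cweight p r l :> R by exact/ltW/cweight_gt0.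
split.
- by move=> X; rewrite mulr_ge0 ?ler0n // ltW.
- move=> A; rewrite sum_indicator_mass //.
  have := card_selected_lower p_pr m_gt0 A ok eE kE; set V := #|_|%N => hV.
  have min_b i : (b < minn (e i) U)%N.
    by apply: leq_ltn_trans (U4 i); apply: leq_trans bh' _; rewrite leq_addr.
  have hC := sum_cutoff min_b U2.
  have key : (p ^ (h * (m + n)) * p ^ (E * (m * n)) <=
      p ^ (\sum_i e i) * V * (2 * m * p ^ (n * b + n) * p ^ (k * (m * n))))%N.
    have -> : (\sum_i e i = \sum_i (e i - g i) + \sum_i g i)%N.
      rewrite -big_split; apply: eq_bigr => i _ /=; rewrite subnK // /g /cutoff.
      exact: leq_trans (leq_subr _ _) (geq_minl _ _).
    have -> : (E * (m * n) = (E - k) * (m * n) + k * (m * n))%N by rewrite -mulnDl subnK.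
    rewrite [(p ^ ((E - k) * _ + _))%N]expnD [(p ^ (_ + \sum_i _))%N]expnD.
    apply: leq_trans (_ : p ^ (\sum_i g i + n * b + n) *
      (2 * m * p ^ (\sum_i (e i - g i)) * V * p ^ (k * (m * n))) <= _)%N.
      by rewrite leq_mul ?leq_exp2l ?prime_gt1 // leq_mul.
    by rewrite -addnA [(p ^ (_ + (n * b + n)))%N]expnD; apply: eq_leq; ring.
  rewrite /c cweight_nat // -invfM -natrM -[leLHS]mul1r ler_pdivrMr; last first.
    by rewrite natrM mulr_gt0 ?pn0 // natrM mulr_gt0 ?pn0 // ltr0n muln_gt0.
  rewrite /W -mulrA mulrAC ler_pdivlMr ?mulr_gt0 // mul1r mulrA.
  by rewrite -!natrM ler_nat.
- move=> A l lN.
  have lU : (l <= U)%N.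
    by have := U4 (Ordinal n_gt0); lia.
  apply: le_trans (upper A l _) _; first by lia.
  rewrite ler_pM2r ?cweight_gt0 //; apply: le_trans C0C.
  by rewrite ler_piMr ?ler0n // small.
- move=> A l lE; apply: le_trans (upper A l lE) _.
  case: (leqP l U) => lU.
    have -> : (l - l1 = 0)%N by apply/eqP; exact: leq_trans lU U3.
    rewrite cweight0 // mulr1; apply: ler_pM => //.
    + by apply: le_trans C0C; rewrite ler_piMr ?ler0n // small.
    + by rewrite cwd ler_piMr // cweight_le1.
  (* Beyond level l1, where all e_i are reached, the exponent is constant. *)
  have l0 : (0 < minn l l1)%N by rewrite leq_min; lia.
  have sE : spread b e U l = (\sum_i minn (minn l l1) (e i))%N.
    rewrite spread_large ?(ltnW lU) //; apply: eq_bigr => i _.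
    by rewrite -minnA; congr minn; apply/esym/minn_idPr; exact: (@leq_bigmax _ e).
  have ratio : (p ^ spread b e U l)%N%:R / (p ^ (h * (m + n)))%N%:R <=
     (p ^ n)%N%:R / cweight p (d - s) (minn l l1) :> R.
    rewrite !ppow_nat // /cweight -!powRN -!ppowD // opprK.
    by apply: ppow_le => //; rewrite sE; have := sum_min_level_le h0 l0; lra.
  apply: le_trans (_ : C0%:R * ((p ^ n)%N%:R / cweight p (d - s) (minn l l1)) *
    cweight p d l <= _).
    by rewrite ler_wpM2r // ler_wpM2l ?ler0n.
  have -> : cweight p d l = cweight p s l * (cweight p (d - s) (minn l l1) *
    cweight p (d - s) (l - l1)).
    by rewrite cwd -cweight_add //; congr (_ * cweight _ _ _); lia.
  rewrite /C natrM.
  have := cweight_gt0 p_pr (d - s) (minn l l1); set x := cweight p _ (minn l l1) => x0.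
  rewrite le_eqVlt; apply/orP; left; apply/eqP; field.
  by rewrite gt_eqF.
- move=> X nuX; have SX : S (reprmx X).
    by apply: contraTT nuX => /negPf ->; rewrite mulr0 ltxx.
  have [i|a [a0 ah aN ae]] := selected_height _ SX.
    exact: leq_trans (leq_subr _ _) (geq_minl _ _).
  exists a, e; split=> //.
    apply: leq_ltn_trans aN; apply: leq_trans (_ : p ^ N <= _)%N.
      by rewrite ltnW // ltn_expl ?prime_gt1.
    by rewrite leq_exp2l ?prime_gt1 //; lia.
  move=> i; have Ha : 0 < (int_height a)%:R :> R by rewrite ltr0n; apply: leq_ltn_trans aN.
  rewrite powRN ltf_pV2 ?posrE ?powR_gt0 //.
  apply: le_lt_trans (_ : (p ^ h)%N%:R `^ tau i < _).
    apply: ge0_ler_powR; rewrite ?nnegrE ?ler0n ?(ltW (tau_gt0 i)) //.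
    by rewrite ler_nat; apply/bigmax_leqP => c0 _; exact: ah.
  rewrite !ppow_nat // -powRrM; apply: ppow_lt => //; exact: level_gt.
Qed.

End ScaleReal.

(** * Superposition of scales *)

Section Combine.
Variables (R : realType) (p m n : nat) (tau : 'I_n -> R) (s : R).
Hypothesis p_pr : prime p.
Hypothesis m_gt0 : (0 < m)%N.
Hypothesis n_gt0 : (0 < n)%N.
Hypothesis tau_gt1 : forall i, 1 < tau i.
Hypothesis tau_sum : (m + n)%:R < \sum_(i < n) tau i.
Let d : R := (m * n)%:R.
Hypothesis s_lt : s < d.
Hypothesis s_opt : forall x : R, 0 < x ->
  \sum_(i < n) Num.min x (tau i) - (m + n)%:R <= x * (d - s).
Local Notation resmx := (resmx p m n).
Let eta := d - s.
Let eta0 : 0 < eta. Proof. by rewrite subr_gt0. Qed.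

Definition mass E (nu : resmx E -> R) l (A : 'M[int]_(m, n)) : R :=
  \sum_(X | congmx p l (reprmx X) A) nu X.

Let cw0' r l : 0 <= cweight p r l :> R. Proof. exact/ltW/cweight_gt0. Qed.
Let cwd l : cweight p d l = cweight p s l * cweight p eta l.
Proof. by rewrite -cweightD // addrC subrK. Qed.

Lemma massD E (nu nu' : resmx E -> R) l A :
  mass (fun X => nu X + nu' X) l A = mass nu l A + mass nu' l A.
Proof. exact: big_split. Qed.

(** Induction on the number L of scales. The new scale is chosen so fine that
the measure built before is uniform, and small compared with r^s / L, at the
radii r where the new one is no longer dominated by Haar measure. So at each
radius one scale contributes with the exponent s, and the coarser ones
together no more than that, whence the constant 2 C; the finer ones contribute
with the exponent d. *)
Lemma stack_scales : exists C c : R, [/\ 0 < C, 0 < c &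
  forall k N Lm L : nat, (L <= Lm)%N -> exists l1, [/\ (k <= l1)%N, (N <= l1)%N &
  forall E, (l1 <= E)%N -> exists nu : resmx E -> R,
  [/\ forall X, 0 <= nu X,
     forall A, L%:R * c * cweight p d k <= mass nu k A,
     forall A l, (l <= E)%N -> mass nu l A <=
       2 * C * cweight p s l + L%:R * C * cweight p d l,
     forall A l, (l1 <= l <= E)%N ->
       mass nu l A <= L%:R * C * cweight p s l * cweight p eta (l - l1) &
     forall X, 0 < nu X -> witness p tau N E (reprmx X)]]].
Proof.
have [C [c [C0 c0 SM]]] := scale_measure p_pr m_gt0 n_gt0 tau_gt1 tau_sum s_lt s_opt.
exists C, c; split=> // k N Lm.
have Lm0 : 0 < Lm.+1%:R^-1 :> R by rewrite invr_gt0 ltr0n.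
have [q hq] := cweight_small p_pr eta0 Lm0.
elim=> [_|L IH LLm].
  exists (maxn k N); split; rewrite ?leq_maxl ?leq_maxr // => E hE.
  exists (fun=> 0); split=> //.
  - by move=> A; rewrite !mul0r /mass big1.
  - by move=> A l _; rewrite /mass big1 // !mul0r addr0 !mulr_ge0 ?ler0n ?(ltW C0).
  - by move=> A l _; rewrite /mass big1 // !mul0r.
  - by move=> X; rewrite ltxx.
have [l1 [kl1 Nl1 IHE]] := IH (ltnW LLm).
have [l2 [_ [l12 SE]]] := SM k (l1 + q)%N.
have l12' : (l1 <= l2)%N by apply: leq_trans l12; exact: leq_addr.
exists l2; split; [exact: leq_trans l12'|exact: leq_trans l12'|].
move=> E l2E; have [nu [nu0 nua nuc nud nue]] := IHE E (leq_trans l12' l2E).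
have [mu [mu0 mua mub muc mue]] := SE E l2E.
exists (fun X => nu X + mu X).
have LC0 : 0 <= L%:R * C by rewrite mulr_ge0 ?ler0n // ltW.
split.
- by move=> X; rewrite addr_ge0.
- by move=> A; rewrite massD -[L.+1%:R]natr1 mulrDl mulrDl mul1r; apply: lerD;
  [exact: nua|exact: mua].
- move=> A l lE; rewrite massD; case: (leqP l (l1 + q)) => lq.
    have -> : L.+1%:R * C * cweight p d l = L%:R * C * cweight p d l + C *
      cweight p d l :> R.
      by rewrite -natr1; ring.
    by rewrite addrA; apply: lerD; [exact: nuc|exact: mub].
  apply: le_trans (_ : 2 * C * cweight p s l <= _); last first.
    by rewrite lerDl !mulr_ge0 ?ler0n ?(ltW C0).
  have -> : 2 * C * cweight p s l = C * cweight p s l + C * cweight p s l :> R by ring.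
  apply: lerD.
    have /(nud A)/le_trans : (l1 <= l <= E)%N.
      by rewrite lE andbT ltnW // (leq_ltn_trans _ lq) ?leq_addr.
    apply; rewrite [L%:R * C]mulrC -!mulrA ler_pM2l // mulrCA ler_piMr //.
    apply: le_trans (_ : Lm.+1%:R * cweight p eta q <= 1).
      apply: ler_pM => //; first by rewrite ler_nat ltnW // ltnS ltnW.
      by apply: cweight_le => //; [exact: ltW|move: lq; clear; lia].
    by rewrite mulrC -ler_pdivlMr ?ltr0n // mul1r.
  apply: le_trans (muc A l lE) _;
    by rewrite ler_piMr ?cweight_le1 ?(ltW eta0) ?mulr_ge0 ?(ltW C0).
- move=> A l /andP[l2l lE]; rewrite massD -[L.+1%:R]natr1 !mulrDl mul1r; apply: lerD.
    have /(nud A)/le_trans : (l1 <= l <= E)%N by rewrite (leq_trans l12').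
    apply; rewrite ler_wpM2l ?mulr_ge0 ?(ltW C0) //.
    by apply: cweight_le => //; [exact: ltW|exact: leq_sub2l].
  exact: muc.
- move=> X; have [nuX _|] := ltP 0 (nu X); first exact: nue.
  move=> nuX numu; have muX : 0 < mu X by apply: lt_le_trans numu _; rewrite gerDr.
  by apply: witness_le (mue X muX); exact: leq_trans Nl1 (leq_addr q l1).
Qed.

(** With about rho^(s - d) scales for a ball of radius rho = p^(-k), the mass
of the ball is of order rho^s, while the terms with the exponent d in
[stack_scales] remain below the order of r^s at every radius r <= rho. At the
last level E, far below the finest scale, the mass is uniform and the bound
holds with the constant 1 in place of K; this is what allows the construction
to be iterated without losing a constant at each step. *)
Theorem local_measure : exists2 K : R, 1 <= K & forall k N : nat,
  exists E, [/\ (k < E)%N, (N <= E)%N & exists nu : resmx E -> R,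
  [/\ forall X, 0 <= nu X,
     forall A, 0 < mass nu k A,
     forall A B l, (k <= l <= E)%N ->
       mass nu l B <= K * (cweight p s l / cweight p s k) * mass nu k A,
     forall A B, mass nu E B <= cweight p s E / cweight p s k * mass nu k A &
     forall X, 0 < nu X -> witness p tau N E (reprmx X)]].
Proof.
have [C [c [C0 c0 SM]]] := stack_scales.
exists (4 * C / c + 1); first by rewrite lerDr divr_ge0 ?mulr_ge0 // ltW.
move=> k N.
have ce0 : 0 < cweight p eta k by apply: cweight_gt0.
(* x is rho^(s - d) for rho = p^(-k), and L is a number of scales between x
and 2 x. *)
pose x := (cweight p eta k)^-1; pose L := (Num.truncn x).+1.
have x1 : 1 <= x by rewrite invf_ge1 // cweight_le1 // ltW.
have xL : x <= L%:R by apply: ltW; exact: truncnS_gt.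
have Lx : L%:R <= 2 * x.
  have /andP[tx _] := truncn_itv (le_trans ler01 x1).
  by rewrite /L -natr1; lra.
have [l1 [kl1 Nl1 SE]] := SM k N L L (leqnn L).
have LC0 : 0 < L%:R * C by rewrite mulr_gt0 ?ltr0n.
have [q hq] := cweight_small p_pr eta0 (divr_gt0 c0 LC0).
pose E := (l1 + q).+1.
have l1E : (l1 <= E)%N by rewrite leqW // leq_addr.
exists E; split; [by rewrite ltnS (leq_trans kl1) ?leq_addr|exact: leq_trans l1E|].
have [nu [nu0 nua nuc nud nue]] := SE E l1E.
exists nu.
have Vge A : c * cweight p s k <= mass nu k A.
  apply: le_trans (nua A); rewrite cwd [L%:R * c]mulrC -!mulrA ler_pM2l //.
  rewrite mulrCA ler_peMr //.
  by rewrite -ler_pdivrMr // mul1r.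
have cs0 : 0 < cweight p s k by apply: cweight_gt0.
split=> //.
- by move=> A; apply: lt_le_trans (Vge A); rewrite mulr_gt0.
- move=> A B l /andP[kl lE]; apply: le_trans (nuc B l lE) _.
  apply: le_trans (_ : 4 * C * cweight p s l <= _).
    suff : L%:R * C * cweight p d l <= 2 * C * cweight p s l by lra.
    rewrite cwd [L%:R * C]mulrC [2 * C]mulrC -!mulrA ler_pM2l // mulrCA [leRHS]mulrC.
    rewrite ler_wpM2l //; apply: le_trans (_ : 2 * x * cweight p eta k <= _).
      apply: ler_pM => //; by apply: cweight_le => //; exact: ltW.
    by rewrite -mulrA mulVf ?mulr1 // gt_eqF.
  set y := cweight p s l / cweight p s k; set V := mass nu k A.
  have -> : (4 * C / c + 1) * y * V = 4 * C / c * y * V + y * V by ring.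
  rewrite -[leLHS]addr0 lerD //; last first.
    by rewrite mulr_ge0 ?divr_ge0 // (le_trans _ (Vge A)) // mulr_ge0 // ltW.
  apply: le_trans (_ : 4 * C / c * (cweight p s l / cweight p s k) * (c *
    cweight p s k) <= _).
    rewrite /y le_eqVlt; apply/orP; left; apply/eqP; field.
    by rewrite !gt_eqF.
  apply: ler_wpM2l; last exact: Vge.
  by rewrite mulr_ge0 ?divr_ge0 ?mulr_ge0 ?(ltW C0) ?(ltW c0).
- move=> A B; have /(nud B)/le_trans : (l1 <= E <= E)%N by rewrite l1E leqnn.
  apply; apply: le_trans (_ : c * cweight p s E <= _).
    rewrite mulrAC ler_wpM2r //; apply: le_trans (_ : L%:R * C * cweight p eta q <= _).
      rewrite ler_pM2l //; apply: cweight_le => //; first exact: ltW.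
      by rewrite leq_subRL // leqW.
    by rewrite mulrC -ler_pdivlMr.
  by rewrite mulrAC ler_pdivlMr // [c * _]mulrC -mulrA ler_pM2l ?cweight_gt0.
Qed.

End Combine.

(** * Escaping a family of balls *)

Section GoodLeaf.
Variables (R : realType) (p m n : nat) (tau : 'I_n -> R) (s K : R).
Hypothesis p_pr : prime p.
Hypothesis K1 : 1 <= K.
Local Notation resmx := (resmx p m n).
Implicit Types (A B : 'M[int]_(m, n)).

(** The cost of a member (B, j) of the family relative to the ball (A, l).
Inside that ball it is the bound of [local_measure] on the relative mass of
the member. A member that contains the ball strictly costs 1, so that a total
cost below 1 excludes it. *)
Definition hit B j A l : R :=
  if (j < l)%N then (congmx p j A B)%:R
  else (congmx p l A B)%:R * (K * (cweight p s j / cweight p s l)).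

Let K0 : 0 <= K. Proof. exact: le_trans ler01 K1. Qed.
Let cw0' r l : 0 <= cweight p r l :> R. Proof. exact/ltW/cweight_gt0. Qed.

Lemma hit_ge0 B j A l : 0 <= hit B j A l.
Proof. by rewrite /hit; case: ifP => _; rewrite ?ler0n // !mulr_ge0 ?invr_ge0 ?ler0n. Qed.

(** The conclusions of [local_measure] that concern a single ball, of centre A
and level k. *)
Definition localized E k A (nu : resmx E -> R) :=
  [/\ forall X, 0 <= nu X,
     forall B l, (k <= l <= E)%N ->
       mass nu l B <= K * (cweight p s l / cweight p s k) * mass nu k A &
     forall B, mass nu E B <= cweight p s E / cweight p s k * mass nu k A].

(** Passing from a ball to its parts does not increase the average cost. A
family member that contains the ball costs 1 before and after; one of
intermediate radius costs its mass after and K (r / rho)^s before, for rho the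
radius of the ball; for one of radius below p^(-E) the constant K occurs on
both sides, so that the mass bound at level E must hold without it. *)
Lemma hit_mass E k A nu B j : (k <= E)%N -> @localized E k A nu ->
  \sum_(X | congmx p k (reprmx X) A) nu X * hit B j (reprmx X) E <=
    mass nu k A * hit B j A k.
Proof.
move=> kE [nu0 nuK nuE]; rewrite {2}/hit; case: ltnP => jk.
  rewrite /mass big_distrl le_eqVlt; apply/orP; left; apply/eqP.
  apply: eq_bigr => X XA; rewrite /hit (leq_trans jk kE).
  by rewrite (congmx_eqr _ (congmx_le (ltnW jk) XA)).
have [AB|nAB] := boolP (congmx p k A B); last first.
  rewrite mul0r mulr0 big1 // => X XA; rewrite /hit; case: ltnP => [jE|Ej].
    case: (boolP (congmx p j (reprmx X) B)) => [XB|]; last by rewrite mulr0.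
    by case/negP: nAB; apply: congmx_trans (congmx_le jk XB); rewrite congmx_sym.
  case: (boolP (congmx p E (reprmx X) B)) => [XB|]; last by rewrite mul0r mulr0.
  by case/negP: nAB; apply: congmx_trans (congmx_le kE XB); rewrite congmx_sym.
rewrite mul1r /hit; case: ltnP => jE.
  apply: le_trans (_ : mass nu j B <= _); last first.
    by rewrite [leRHS]mulrC; apply: nuK; rewrite jk ltnW.
  rewrite /mass big_mkcond [leRHS]big_mkcond; apply: ler_sum => X _.
  by case: ifP => _; case: ifP => _; rewrite ?mulr1 ?mulr0.
apply: le_trans (_ : mass nu E B * (K * (cweight p s j / cweight p s E)) <= _).
  rewrite /mass big_distrl /= big_mkcond [leRHS]big_mkcond; apply: ler_sum => X _.
  case: ifP => _; case: ifP => _; rewrite ?mul1r ?mul0r ?mulr0 //.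
  by rewrite !mulr_ge0 ?invr_ge0.
apply: le_trans (ler_wpM2r _ (nuE B)) _; first by rewrite !mulr_ge0 ?invr_ge0.
rewrite le_eqVlt; apply/orP; left; apply/eqP; field.
by rewrite !gt_eqF ?cweight_gt0.
Qed.

Local Open Scope ereal_scope.
Variables (B : nat -> 'M[int]_(m, n)) (j : nat -> nat).

(** The total cost of the family; a load below 1 means that no member contains
the ball strictly and that the members inside it are small. *)
Definition load A l : \bar R := \sum_(i <oo) (hit (B i) (j i) A l)%:E.

(** By [hit_mass] the average of the loads of the parts is at most the load of
the ball. *)
Lemma good_leaf E k A nu : (k <= E)%N -> @localized E k A nu ->
  (0 < mass nu k A)%R -> load A k < 1 ->
  exists X : resmx E, [/\ congmx p k (reprmx X) A, (0 < nu X)%R & load (reprmx X) E < 1].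
Proof.
move=> kE loc V0 lA; have [nu0 _ _] := loc.
apply: contrapT => nex.
have all1 (X : resmx E) : congmx p k (reprmx X) A -> (nu X)%:E <=
  (nu X)%:E * load (reprmx X) E.
  move=> XA; have := nu0 X; rewrite le_eqVlt => /predU1P[<-|nuX]; first by rewrite mul0e.
  rewrite -[leLHS]mule1 lee_pmul2l // leNgt; apply/negP => lX.
  by apply: nex; exists X.
suff : (mass nu k A)%:E <= (mass nu k A)%:E * load A k.
  rewrite -{1}[(mass _ _ _)%:E]mule1 lee_pmul2l // leNgt.
  by rewrite lA.
apply: le_trans (_ : \sum_(X | congmx p k (reprmx X) A) (nu X)%:E * load (reprmx X) E <= _).
  by rewrite /mass -sumEFin; apply: lee_sum.
rewrite /load -nneseriesZl; last by move=> i _; rewrite lee_fin hit_ge0.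
under eq_bigr => X _.
  rewrite -nneseriesZl; last by move=> i _; rewrite lee_fin hit_ge0.
  over.
rewrite -nneseries_sum; last first.
  by move=> X i _; rewrite mule_ge0 ?lee_fin ?hit_ge0.
apply: lee_nneseries => [i _ _|i _].
  by apply: sume_ge0 => X _; rewrite mule_ge0 ?lee_fin ?hit_ge0.
rewrite -EFinM; under eq_bigr do rewrite -EFinM.
by rewrite sumEFin lee_fin hit_mass.
Qed.

(** At level k a member of radius at most p^(-k) meets exactly one ball. The
average of the loads over the p^(k m n) balls is therefore the sum of the
costs divided by their number. *)
Lemma initial_leaf k : (forall i, (k <= j i)%N) ->
  \sum_(i <oo) (cweight p s (j i))%:E < (cweight p s k / K * (p ^ (k * (m * n)))%N%:R)%:E ->
  exists X : resmx k, load (reprmx X) k < 1.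
Proof.
move=> kj small; apply: contrapT => nex.
have all1 (X : resmx k) : 1 <= load (reprmx X) k.
  by rewrite leNgt; apply/negP => lX; apply: nex; exists X.
have Kgt : (0 < K)%R by exact: lt_le_trans ltr01 K1.
have c0 : (0 < cweight p s k :> R)%R by exact: cweight_gt0.
have : (p ^ (k * (m * n)))%N%:R%:E <= \sum_(X : resmx k) load (reprmx X) k.
  apply: le_trans (_ : \sum_(X : resmx k) 1 <= _); last by apply: lee_sum.
  by rewrite sumEFin sumr_const card_resmx.
rewrite leNgt => /negP; apply.
rewrite /load -nneseries_sum; last by move=> X i _; rewrite lee_fin hit_ge0.
have -> : \sum_(0 <= i <oo) \sum_(X : resmx k) (hit (B i) (j i) (reprmx X) k)%:E =
    \sum_(0 <= i <oo) (K / cweight p s k)%:E * (cweight p s (j i))%:E.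
  apply: eq_eseriesr => i _; rewrite sumEFin -EFinM; congr EFin.
  rewrite (bigD1 (redmx p k (B i))) //= big1 ?addr0 => [|X XB]; rewrite /hit ltnNge kj /=.
    by rewrite reprmx_redmx // mul1r mulrA mulrAC.
  case: (boolP (congmx _ _ _ _)) => [XB'|]; last by rewrite mul0r.
  by case/eqP: XB; rewrite -(reprmxK p_pr X); apply: redmx_eq.
rewrite nneseriesZl; last by move=> i _; rewrite lee_fin.
rewrite muleC -lte_pdivlMr; last by rewrite divr_gt0.
apply: lt_le_trans small _; rewrite -EFinM lee_fin invf_div.
by rewrite mulrC.
Qed.

End GoodLeaf.

(** * The p-adic numbers and their integer approximations *)

Section QpFacts.
Variables (R : realType) (p : nat).
Hypothesis p_pr : prime p.
Local Notation nrm := (padic_absq p).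
Local Notation abs := (@padic_abs R p).
Local Notation pi := (\pi_(Qp p)%qT).
Implicit Types (u v : padic_seq p) (x y : Qp p) (z : int).

Lemma padic_abs_pi_le u (e : R) (N : nat) :
  (forall i, (N <= i)%N -> ratr (nrm (u i)) <= e) -> abs (pi u) <= e.
Proof.
move=> h; apply: (ler_cvg_to (@padic_abs_pi R p u) (cvg_cst e)).
by exists N => // i /= Ni; exact: h.
Qed.

Lemma padic_absM x y : abs (x * y) = abs x * abs y.
Proof.
rewrite -[in LHS](reprK x) -[in LHS](reprK y) -rmorphM.
apply: (cvg_unique (@Rhausdorff R) (@padic_abs_pi R p (repr x * repr y))).
apply: cvg_trans (cvgM (@padic_abs_repr R p x) (@padic_abs_repr R p y)).
apply: near_eq_cvg; apply: nearW => i /=.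
by rewrite -rmorphM -padic_absqM.
Qed.

Lemma padic_abs_max x y (e : R) : abs x <= e -> abs y <= e -> abs (x + y) <= e.
Proof.
move=> xe ye; apply/ler_addgt0Pr => t t0.
have xet : abs x < e + t by rewrite ltr_pwDr.
have yet : abs y < e + t by rewrite ltr_pwDr.
have [N _ hN] := cvgr_lt _ (@padic_abs_repr R p x) _ xet.
have [M _ hM] := cvgr_lt _ (@padic_abs_repr R p y) _ yet.
rewrite -(reprK x) -(reprK y) -rmorphD.
apply: (@padic_abs_pi_le _ _ (maxn N M)) => i; rewrite geq_max => /andP[Ni Mi].
have := hN i Ni; have := hM i Mi => /= h1 h2.
apply: le_trans (_ : ratr (Num.max (nrm (repr x i)) (nrm (repr y i))) <= _).
  by rewrite ler_rat; exact: padic_absqD.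
by rewrite /Order.max; case: ifP => _; apply: ltW.
Qed.

Lemma padic_abs_sum (I : Type) (r : seq I) (P : pred I) (F : I -> Qp p) (e : R) :
  0 <= e -> (forall i, P i -> abs (F i) <= e) -> abs (\sum_(i <- r | P i) F i) <= e.
Proof.
move=> e0 h; elim/big_ind: _ => //; first by rewrite padic_abs0.
by move=> x y; exact: padic_abs_max.
Qed.

Lemma padic_const_subproof (q : rat) : (fun=> q) \in padic_cauchy p.
Proof.
by apply/padic_cauchyP => e e0; exists 0%N => i j _ _; rewrite subrr padic_absq0.
Qed.
Definition padic_const q : padic_seq p := PadicSeq (padic_const_subproof q).

Lemma padic_constB q r : padic_const (q - r) = padic_const q - padic_const r.
Proof. by apply: val_inj. Qed.

Lemma padic_const_int z : padic_const z%:~R = z%:~R.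
Proof.
have cD q r : padic_const (q + r) = padic_const q + padic_const r by exact: val_inj.
have cN q : padic_const (- q) = - padic_const q by exact: val_inj.
have cnat (k : nat) : padic_const k%:R = k%:R.
  elim: k => [|k IH]; first exact: val_inj.
  by rewrite -!natr1 cD IH; congr (_ + _); exact: val_inj.
case: z => k; first exact: cnat.
by rewrite NegzE !mulrNz cN; congr (- _); exact: cnat.
Qed.

Lemma padic_abs_const q : abs (pi (padic_const q)) = ratr (nrm q).
Proof.
apply: (cvg_unique (@Rhausdorff R) (@padic_abs_pi R p (padic_const q))).
by apply: cvg_near_cst; apply: nearW.
Qed.

Lemma pi_int z : pi (z%:~R : padic_seq p) = z%:~R.
Proof. exact: rmorph_int. Qed.

Lemma padic_abs_int z : abs z%:~R = ratr (nrm z%:~R).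
Proof. by rewrite -pi_int -padic_const_int padic_abs_const. Qed.

Lemma padic_absq_int_le z k : (nrm z%:~R <= (p ^ k)%N%:R^-1) = ((p ^ k)%N%:Z %| z)%Z.
Proof.
have [->|z0] := eqVneq z 0.
  by rewrite padic_absq0 dvdz0 invr_ge0 ler0n.
have p1 : 1 < p%:R :> rat by rewrite ltr1n prime_gt1.
have := padic_absq_frac p z0 (isT : (1 : int) != 0).
rewrite divr1 p_pr logn1 => ->; rewrite sub0r natrX.
rewrite !exprnN ler_eXz2l // lerN2 lez_nat -pfactor_dvdn ?absz_gt0 //.
Qed.

(** Divisibility by p^k is closeness to 0; this is the dictionary between
congruences of integer matrices and distances. *)
Lemma padic_abs_int_le z k : (abs z%:~R <= (p ^ k)%N%:R^-1) = ((p ^ k)%N%:Z %| z)%Z.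
Proof.
rewrite padic_abs_int -padic_absq_int_le -(ler_rat R) fmorphV /=.
by rewrite ratr_nat.
Qed.

(** The absolute value takes only the values p^(-k) and 0, so a strict
inequality gains a factor p. *)
Lemma padic_abs_int_lt z k : abs z%:~R < (p ^ k)%N%:R^-1 -> ((p ^ k.+1)%N%:Z %| z)%Z.
Proof.
have [-> _|z0] := eqVneq z 0; first exact: dvdz0.
have p1 : 1 < p%:R :> rat by rewrite ltr1n prime_gt1.
rewrite padic_abs_int -[X in _ < X^-1](ratr_nat R) -fmorphV ltr_rat.
have := padic_absq_frac p z0 (isT : (1 : int) != 0).
rewrite divr1 p_pr logn1 => ->; rewrite sub0r natrX.
rewrite !exprnN ltr_eXz2l // ltrN2 ltz_nat => h.
by rewrite dvdzE /= pfactor_dvdn ?absz_gt0.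
Qed.

Lemma padic_abs_int1 z : abs z%:~R <= 1.
Proof. by have := padic_abs_int_le z 0; rewrite expn0 invr1 dvd1z => ->. Qed.

(** A rational number close to x has a denominator prime to p, which is
invertible modulo p^k. *)
Lemma padic_int_dense x k : abs x <= 1 -> exists z, abs (x - z%:~R) <= (p ^ k)%N%:R^-1.
Proof.
move=> x1; have pk0 : 0 < (p ^ k)%N%:R^-1 :> rat.
  by rewrite invr_gt0 ltr0n expn_gt0 prime_gt0.
pose u : padic_seq p := repr x.
have /padic_cauchyP/(_ _ pk0)[N uN] := valP u.
have xu : abs (x - pi (padic_const (u N))) <= (p ^ k)%N%:R^-1.
  rewrite -[X in abs (X - _)](reprK x) -rmorphB.
  apply: (@padic_abs_pi_le _ _ N) => i Ni.
  have := ltW (uN i N Ni (leqnn N)); rewrite -(ler_rat R) fmorphV /= ratr_nat; exact.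
have pk1 : (p ^ k)%N%:R^-1 <= 1 :> R.
  by rewrite invf_le1 ?ler1n ?ltr0n ?expn_gt0 ?prime_gt0.
have : abs (pi (padic_const (u N))) <= 1.
  rewrite -[pi _](subrK x) padic_abs_max // -opprB padic_absN.
  exact: le_trans xu pk1.
rewrite padic_abs_const => h1; have u1 : nrm (u N) <= 1 by rewrite -(ler_rat R) rmorph1.
clear h1; set q := u N in xu u1 *.
have [b [c [cb cn0 pc]]] : exists b c :
  int, [/\ q * c%:~R = b%:~R, c != 0 & ~~ (p %| `|c|)%N].
  exists (numq q), (denq q); split; rewrite ?denq_neq0 //.
    by rewrite -{1}(divq_num_den q) divfK // intr_eq0 denq_neq0.
  apply/negP => pd.
  have q0 : q != 0 by apply: contraTneq pd => ->; rewrite /= dvdn1 gtn_eqF // prime_gt1.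
  move: u1; rewrite /padic_absq (negPf q0).
  rewrite -[X in _ <= X](expr0z (p%:R : rat)) ler_eXz2l ?ltr1n ?prime_gt1 //.
  apply/negP; rewrite -ltNge subr_gt0 ltz_nat.
  have : ~~ (p %| `|numq q|)%N.
    apply/negP => pn; have := coprime_num_den q; rewrite /coprime => /eqP g1.
    by have := dvdn_gcd p `|numq q| `|denq q|; rewrite g1 pn pd dvdn1 gtn_eqF ?prime_gt1.
  rewrite -[X in (X < _)%N]/(logn p `|numq q|) => pn.
  by rewrite (@lognE p `|numq q|) (negPf pn) !andbF logn_gt0 mem_primes p_pr absz_gt0 denq_neq0.
have [v [w vw]] := Bezoutz (p ^ k)%N%:Z c.
have g1 : gcdz (p ^ k)%N%:Z c = 1.
  by apply/eqP; rewrite -[_ == _]/(coprimez _ _) coprimezE /= coprimeXl // prime_coprime.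
rewrite g1 in vw.
exists (b * w); have c0 : c%:~R != 0 :> rat by rewrite intr_eq0.
rewrite -[x](subrK (pi (padic_const q))) -addrA; apply: padic_abs_max => //.
rewrite -pi_int -rmorphB -padic_const_int -padic_constB padic_abs_const.
rewrite -(ratr_nat R) -fmorphV ler_rat.
have -> : q - (b * w)%:~R = (b * (v * (p ^ k)%N))%:~R / c%:~R.
  have -> : q = b%:~R / c%:~R by rewrite -cb mulfK.
  have -> : v * (p ^ k)%N = 1 - w * c by rewrite -vw addrK.
  by rewrite !rmorphM rmorphB rmorphM /=; field.
rewrite padic_absqM padic_absqV.
have -> : nrm c%:~R = 1.
  have := padic_absq_frac p cn0 (isT : (1 : int) != 0).
  by rewrite divr1 p_pr logn1 lognE (negPf pc) !andbF subrr expr0z.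
by rewrite invr1 mulr1 padic_absq_int_le mulrA dvdz_mull ?dvdzz.
Qed.

(** The compatible integers, seen as rational numbers, form a Cauchy sequence,
which is a point of the completion by construction. *)
Lemma padic_int_limit (a : nat -> int) (E : nat -> nat) :
  (forall r, (E r < E r.+1)%N) ->
  (forall r, ((p ^ E r)%N%:Z %| a r.+1 - a r)%Z) ->
  exists2 x : Qp p, abs x <= 1 & forall r, abs (x - (a r)%:~R) <= (p ^ E r)%N%:R^-1.
Proof.
move=> Einc adv.
have adv' r i : (r <= i)%N -> ((p ^ E r)%N%:Z %| a i - a r)%Z.
  move=> ri; rewrite -(subnK ri) addnC; elim: (i - r)%N => [|t IH].
    by rewrite addn0 subrr dvdz0.
  rewrite addnS -[a (r + t).+1](subrK (a (r + t)%N)) -addrA rpredD //.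
  apply: dvdz_trans (adv _); rewrite dvdzE /= dvdn_exp2l //.
  by apply: (@homo_leq _ E leq) => //;
    [exact: leq_trans|move=> j; exact: ltnW|exact: leq_addr].
have Er r : (r <= E r)%N by elim: r => // r IH; exact: leq_ltn_trans (Einc r).
have ac : (fun i => (a i)%:~R : rat) \in padic_cauchy p.
  apply/padic_cauchyP => e e0.
  have [N hN] : exists N : nat, (p ^ N)%N%:R^-1 < e.
    exists (Num.truncn e^-1).+1;
      rewrite -[ltRHS]invrK ltf_pV2 ?posrE ?invr_gt0 ?ltr0n ?expn_gt0 ?prime_gt0 //.
    apply: lt_le_trans (truncnS_gt _) _; rewrite ler_nat ltnW // ltn_expl // prime_gt1 //.
  exists N => i j Ni Nj; apply: le_lt_trans hN; rewrite -rmorphB padic_absq_int_le.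
  have dN k : (N <= k)%N -> ((p ^ N)%N%:Z %| a k - a N)%Z.
    move=> Nk; apply: dvdz_trans (adv' _ _ Nk); rewrite dvdzE /= dvdn_exp2l //.
  have -> : a i - a j = (a i - a N) - (a j - a N) by ring.
  by rewrite rpredB // dN.
pose u : padic_seq p := PadicSeq ac.
have close r : abs (pi u - (a r)%:~R) <= (p ^ E r)%N%:R^-1.
  rewrite -pi_int -padic_const_int -rmorphB; apply: (@padic_abs_pi_le _ _ r) => i ri.
  rewrite -(ratr_nat R) -fmorphV ler_rat -[(_ - _ : padic_seq p) i]/((a i)%:~R - (a r)%:~R).
  by rewrite -rmorphB padic_absq_int_le adv'.
exists (pi u) => //; rewrite -[pi u](subrK (a 0%N)%:~R).
apply: padic_abs_max; last exact: padic_abs_int1.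
apply: le_trans (close 0%N) _.
by rewrite invf_le1 ?ler1n ?ltr0n ?expn_gt0 ?prime_gt0.
Qed.

End QpFacts.

Section PadicMatrices.
Variables (R : realType) (p m n : nat).
Hypothesis p_pr : prime p.
Local Notation abs := (@padic_abs R p).
Local Notation T := (padic_mx R p m n).
Implicit Types (A B : 'M[int]_(m, n)) (X : T).

Definition integral_mx X := forall i j, abs (X i j) <= 1.

Definition near_int l A X := forall i j, abs (X i j - (A i j)%:~R) <= (p ^ l)%N%:R^-1.

Let pV k : 0 <= (p ^ k)%N%:R^-1 :> R. Proof. by rewrite invr_ge0 ler0n. Qed.

Lemma near_int_exists l X : integral_mx X -> exists A, near_int l A X.
Proof.
move=> iX; exists (\matrix_(i, j) projT1 (cid (padic_int_dense p_pr l (iX i j)))).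
by move=> i j; rewrite mxE; case: cid.
Qed.

Lemma near_int_congmx l A B X : near_int l A X -> near_int l B X -> congmx p l A B.
Proof.
move=> hA hB; apply/congmxP => i j; rewrite -(padic_abs_int_le R p_pr) rmorphB /=.
have -> : (A i j)%:~R - (B i j)%:~R = (X i j - (B i j)%:~R) - (X i j - (A i j)%:~R) :> Qp p.
  by ring.
by apply: padic_abs_max; rewrite ?padic_absN.
Qed.

Lemma congmx_near_int l A B X : near_int l A X -> congmx p l A B -> near_int l B X.
Proof.
move=> hA /congmxP AB i j.
have -> : X i j - (B i j)%:~R = (X i j - (A i j)%:~R) + (A i j - B i j)%:~R :> Qp p.
  by rewrite rmorphB /=; ring.
by apply: padic_abs_max; [exact: hA|rewrite padic_abs_int_le].
Qed.

Lemma pinv_le k l : (k <= l)%N -> (p ^ l)%N%:R^-1 <= (p ^ k)%N%:R^-1 :> R.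
Proof.
move=> kl; rewrite lef_pV2 ?posrE ?ltr0n ?expn_gt0 ?prime_gt0 //.
by rewrite ler_nat leq_exp2l // prime_gt1.
Qed.

Lemma near_int_le k l A X : (k <= l)%N -> near_int l A X -> near_int k A X.
Proof. by move=> kl h i j; apply: le_trans (h i j) (pinv_le kl). Qed.

Definition padic_form (a : 'rV[int]_(m + n)) X i : Qp p :=
  (map_mx intr (lsubmx a) *m X) 0 i - (rsubmx a 0 i)%:~R.

Lemma padic_form_zform l A X a i : near_int l A X ->
  abs (padic_form a X i - (zform a A 0 i)%:~R) <= (p ^ l)%N%:R^-1.
Proof.
move=> h; have -> : padic_form a X i - (zform a A 0 i)%:~R =
    \sum_j (lsubmx a 0 j)%:~R * (X j i - (A j i)%:~R).
  rewrite /padic_form zformE rmorphB /= rmorph_sum /= opprB addrA subrK [X in X - _]mxE.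
  rewrite -sumrB; apply: eq_bigr => j _.
  by rewrite rmorphM /= mulrBr [map_mx _ _ _ _]mxE.
apply: padic_abs_sum => // j _; rewrite padic_absM -[leRHS]mul1r ler_pM ?padic_abs_ge0 //.
exact: padic_abs_int1.
Qed.

Lemma near_int_limit (A : nat -> 'M[int]_(m, n)) (E : nat -> nat) :
  (forall r, (E r < E r.+1)%N) -> (forall r, congmx p (E r) (A r.+1) (A r)) ->
  exists2 X : T, integral_mx X & forall r, near_int (E r) (A r) X.
Proof.
move=> Einc h.
have ex i j : exists2 x : Qp p, abs x <= 1 &
    forall r, abs (x - (A r i j)%:~R) <= (p ^ E r)%N%:R^-1.
  by apply: padic_int_limit => // r; move/congmxP: (h r).
exists (\matrix_(i, j) projT1 (cid2 (ex i j))).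
  by move=> i j; rewrite mxE; case: cid2.
by move=> r i j; rewrite mxE; case: cid2.
Qed.

End PadicMatrices.

(** * Points outside a family of balls *)

Section Nested.
Variables (R : realType) (p m n : nat) (tau : 'I_n -> R) (s K : R).
Hypothesis p_pr : prime p.
Hypothesis K1 : 1 <= K.
Local Notation resmx := (resmx p m n).
Hypothesis local_mass : forall k N : nat,
  exists E, [/\ (k < E)%N, (N <= E)%N & exists nu : resmx E -> R,
  [/\ forall X, 0 <= nu X,
     forall A, 0 < mass nu k A,
     forall A B l, (k <= l <= E)%N ->
       mass nu l B <= K * (cweight p s l / cweight p s k) * mass nu k A,
     forall A B, mass nu E B <= cweight p s E / cweight p s k * mass nu k A &
     forall X, 0 < nu X -> witness p tau N E (reprmx X)]].
Variables (B : nat -> 'M[int]_(m, n)) (j : nat -> nat).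
Local Notation load := (load p s K B j).

(** Iteration of [good_leaf], where step r asks for a height above r. *)
Lemma nested_leaves A0 k0 : (load A0 k0 < 1)%E ->
  exists (E : nat -> nat) (A : nat -> 'M[int]_(m, n)),
  [/\ forall r, (E r < E r.+1)%N, forall r, congmx p (E r) (A r.+1) (A r),
      forall r, (load (A r) (E r) < 1)%E &
      forall r, witness p tau r (E r.+1) (A r.+1)].
Proof.
move=> l0; pose state := {u : nat * 'M[int]_(m, n) | (load u.2 u.1 < 1)%E}.
have step (ru : nat * state) : exists v : state,
    [/\ ((sval ru.2).1 < (sval v).1)%N, congmx p (sval ru.2).1 (sval v).2 (sval ru.2).2 &
     witness p tau ru.1 (sval v).1 (sval v).2].
  case: ru => r [[k A] /= lA].
  have [E [kE _ [nu [nu0 nuA nuK nuE nuw]]]] := local_mass k r.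
  have loc : @localized R p m n s K E k A nu by split; [exact: nu0|exact: nuK|exact: nuE].
  have [X [XA nuX lX]] := good_leaf p_pr K1 (ltnW kE) loc (nuA A) lA.
  by exists (exist _ (E, reprmx X) lX); split=> //=; exact: nuw.
have [f fP] := choice step.
pose g := fix g r : state := if r is r'.+1 then f (r', g r') else exist _ (k0, A0) l0.
exists (fun r => (sval (g r)).1), (fun r => (sval (g r)).2); split=> r.
- by have [] := fP (r, g r).
- by have [] := fP (r, g r).
- exact: (svalP (g r)).
- by have [] := fP (r, g r).
Qed.

Lemma load_hit A l i : (j i < l)%N -> congmx p (j i) A (B i) -> (1 <= load A l)%E.
Proof.
move=> jl AB; have h0 i' : (0 <= (hit p s K (B i') (j i') A l)%:E)%E.
  by rewrite lee_fin; apply: hit_ge0.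
rewrite /load (nneseriesD1 (n := i)) //.
by rewrite {1}/hit jl AB leeDl // nneseries_ge0.
Qed.

(** The limit of the nested balls. If it belonged to a member of the family,
that member would eventually contain one of the nested balls strictly, and the
load of this ball would be at least 1. *)
Lemma uncovered_point A0 k0 : (load A0 k0 < 1)%E ->
  exists X : padic_mx R p m n, [/\ integral_mx X,
    (forall i, ~ near_int (j i) (B i) X) &
    forall N, exists a, (N < int_height a)%N /\
      forall i, padic_abs R (padic_form a X i) < (int_height a)%:R `^ (- tau i)].
Proof.
move=> l0; have [E [A [Einc AE lA wA]]] := nested_leaves l0.
have [X iX nX] := near_int_limit R p_pr Einc AE.
have rE r : (r <= E r)%N by elim: r => // r IH; exact: leq_ltn_trans (Einc r).
exists X; split=> // [i nB|N].
  have jE : (j i < E (j i).+1)%N by exact: rE.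
  have : (1 <= load (A (j i).+1) (E (j i).+1))%E.
    apply: (load_hit jE); apply: near_int_congmx nB => //.
    exact: near_int_le (ltnW jE) (nX _).
  by rewrite leNgt lA.
have [a [e [eE aN ae ea]]] := wA N; exists a; split=> // i.
apply: le_lt_trans (ea i); rewrite -[padic_form a X i](subrK (zform a (A N.+1) 0 i)%:~R).
apply: padic_abs_max.
  by apply: le_trans (padic_form_zform p_pr a i (nX N.+1)) _; exact: pinv_le.
by rewrite padic_abs_int_le //; exact: (solvesP _ _ _ _ ae).
Qed.

End Nested.

Local Open Scope classical_set_scope.
Local Open Scope ring_scope.

(** * Infinite Hausdorff measure *)

Section HausdorffBasics.
Variables (R : realType) (T : metricType R).
Local Open Scope ereal_scope.

Lemma diameter_ge0 (A : set T) : 0 <= diameter A.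
Proof. by apply: ereal_sup_ubound; left. Qed.

Lemma mdist_le_diameter (A : set T) x y : A x -> A y -> (mdist x y)%:E <= diameter A.
Proof. by move=> Ax Ay; apply: ereal_sup_ubound; right; exists x, y. Qed.

Lemma diameter_le (A : set T) (e : R) : (0 <= e)%R ->
  (forall x y, A x -> A y -> (mdist x y <= e)%R) -> diameter A <= e%:E.
Proof.
move=> e0 h; apply: ge_ereal_sup => _ [->|[x [y [Ax Ay ->]]]]; rewrite lee_fin //.
exact: h.
Qed.

Lemma hausdorff_weight_ge0 s (A : set T) : 0 <= hausdorff_weight s A.
Proof. by rewrite /hausdorff_weight; case: ifP => // _; exact: poweR_ge0. Qed.

End HausdorffBasics.

Section LowerBound.
Variables (R : realType) (p m n : nat) (s K : R).
Hypothesis p_pr : prime p.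
Hypothesis K1 : 1 <= K.
Hypothesis s_gt0 : 0 < s.
Hypothesis s_lt : s < (m * n)%:R.
Local Notation T := (padic_mx R p m n).

Let p0 : 0 < p%:R :> R. Proof. by rewrite ltr0n prime_gt0. Qed.

Lemma pinv_gt0 k : 0 < (p ^ k)%N%:R^-1 :> R.
Proof. by rewrite invr_gt0 ltr0n expn_gt0 prime_gt0. Qed.

Lemma cweight_powR k : cweight p s k = (p ^ k)%N%:R^-1 `^ s :> R.
Proof. by rewrite /cweight ppow_nat // -powRN -powRrM mulNr. Qed.

Lemma pinv_small (e : R) : 0 < e -> exists N, (p ^ N)%N%:R^-1 < e.
Proof.
move=> e0; exists (Num.truncn e^-1).+1.
rewrite -[ltRHS]invrK ltf_pV2 ?posrE ?invr_gt0 ?ltr0n ?expn_gt0 ?prime_gt0 //.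
apply: lt_le_trans (truncnS_gt _) _.
by rewrite ler_nat ltnW // ltn_expl // prime_gt1.
Qed.

Lemma near_int_ball l B (X Y : T) (e : R) : near_int l B X -> e <= (p ^ l)%N%:R^-1 ->
  mdist Y X <= e -> near_int l B Y.
Proof.
move=> hB el YX i j.
have -> : Y i j - (B i j)%:~R = (Y i j - X i j) + (X i j - (B i j)%:~R) :> Qp p by ring.
apply: padic_abs_max; last exact: hB.
have l0 := ltW (pinv_gt0 l).
by move: i j; apply/(padic_mx_dist_ler Y X l0); exact: le_trans YX el.
Qed.

(** In an ultrametric space a set of diameter D lies in a ball of radius D,
and the next power of p loses at most the factor p^s. The error e is needed
for sets that meet no integral matrix or that have diameter 0, since these
contribute nothing to the Hausdorff sum but are replaced by balls of positive
radius. *)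
Lemma cover_cell (U : set T) k0 (e : R) : 0 < e ->
  (diameter U <= ((p ^ k0)%N%:R^-1)%:E)%E ->
  exists Bj : 'M[int]_(m, n) * nat, [/\ (k0 <= Bj.2)%N,
    forall X, U X -> integral_mx X -> near_int Bj.2 Bj.1 X &
    ((cweight p s Bj.2)%:E <= (p%:R `^ s)%:E * hausdorff_weight s U + e%:E)%E].
Proof.
move=> e0 Uk0.
have [q [kq hq]] : exists q, (k0 <= q)%N /\ cweight p s q <= e :> R.
  have [q hq] := cweight_small p_pr s_gt0 e0; exists (maxn k0 q); rewrite leq_maxl;
    split=> //.
  by apply: le_trans hq; apply: cweight_le => //; [exact: ltW|exact: leq_maxr].
have W0 : (0 <= (p%:R `^ s)%:E * hausdorff_weight s U)%E.
  by rewrite mule_ge0 ?lee_fin ?powR_ge0 ?hausdorff_weight_ge0.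
have hqU : ((cweight p s q)%:E <= (p%:R `^ s)%:E * hausdorff_weight s U + e%:E)%E.
  by rewrite -[leLHS]add0e leeD // lee_fin.
have [[X0 [UX0 iX0]]|nU] := pselect (exists X0, U X0 /\ integral_mx X0); last first.
  exists (0, q); split=> //= X UX iX; case: nU; by exists X.
have [d dE] : exists d : R, diameter U = d%:E.
  have := diameter_ge0 U; case: (diameter U) Uk0 => [d _ _|//|//]; by exists d.
have d0 : 0 <= d by have := diameter_ge0 U; rewrite dE lee_fin.
have dU X : U X -> mdist X X0 <= d.
  by move=> UX; have := mdist_le_diameter UX UX0; rewrite dE lee_fin.
move: d0; rewrite le_eqVlt => /predU1P[d0|d0].
  have [B hB] := near_int_exists p_pr q iX0.
  exists (B, q); split=> //= X UX _; apply: (near_int_ball hB) (dU X UX).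
  by rewrite -d0 ltW // pinv_gt0.
pose P l := d <= (p ^ l)%N%:R^-1.
have Pk0 : exists l, P l by exists k0; rewrite /P -lee_fin -dE.
have [N hN] := pinv_small d0.
have PN l : P l -> (l <= N)%N.
  move=> Pl; rewrite leqNgt; apply/negP => Nl.
  have := lt_le_trans hN (le_trans Pl (pinv_le R p_pr (ltnW Nl))).
  by rewrite ltxx.
case: (ex_maxnP Pk0 PN) => l Pl lmax.
have [B hB] := near_int_exists p_pr l iX0.
exists (B, l); split=> /=.
- by apply: lmax; rewrite /P -lee_fin -dE.
- by move=> X UX _; apply: (near_int_ball hB) (dU X UX).
have U0 : U != set0 by apply/set0P; exists X0.
rewrite /hausdorff_weight (negPf U0) dE poweR_EFin -EFinM -EFinD lee_fin.
apply: le_trans (_ : p%:R `^ s * d `^ s <= _); last by rewrite lerDl ltW.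
have -> : cweight p s l = p%:R `^ s * cweight p s l.+1 :> R.
  rewrite -addn1 cweight_add // mulrCA -[LHS]mulr1; congr (_ * _).
  by rewrite /cweight mul1r powRN divff // gt_eqF // powR_gt0.
rewrite ler_pM2l ?powR_gt0 // cweight_powR; apply: ge0_ler_powR;
  rewrite ?nnegrE ?(ltW s_gt0) ?(ltW (pinv_gt0 _)) ?(ltW d0) //.
rewrite leNgt; apply/negP => dl.
have /lmax : P l.+1 by exact: ltW.
by rewrite ltnn.
Qed.

(** If the Hausdorff sum of a cover by sets of diameter at most p^(-k0) were
less than M, then [cover_cell] and [initial_leaf] would give a ball of level
k0 with load below 1, hence an uncovered point. *)
Theorem hausdorff_measure_infinite (W : set T) :
  (forall X, W X -> integral_mx X) ->
  (forall B j A0 k0, (load p s K B j A0 k0 < 1)%E ->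
     exists2 X, W X & forall i, ~ near_int (j i) (B i) X) ->
  hausdorff_measure s W = +oo%E.
Proof.
move=> iW escape; apply/eq_infty => M.
(* M' bounds the cost of the balls that replace the cover: a factor p^s, and 1
for the sum of the errors. *)
pose M' := p%:R `^ s * `|M| + 1.
have M'0 : 0 < M' by rewrite ltr_wpDl // mulr_ge0 ?powR_ge0.
have Kgt : 0 < K by exact: lt_le_trans ltr01 K1.
have eta0 : 0 < (m * n)%:R - s by rewrite subr_gt0.
have [|k0 hk0] := @cweight_small R p p_pr _ (K * (M' + 1))^-1 eta0.
  by rewrite invr_gt0 mulr_gt0 // addr_gt0.
apply: le_trans (_ : hausdorff_content s (p ^ k0)%N%:R^-1 W <= _)%E; last first.
  by apply: ereal_sup_ubound; exists (p ^ k0)%N%:R^-1 => //=; exact: pinv_gt0.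
apply: le_ereal_inf_tmp => _ [U [WU Uk0] <-].
rewrite leNgt; apply/negP => small.
have e_gt0 i : 0 < 1 / (2 ^ i.+1)%N%:R :> R by rewrite divr_gt0 // ltr0n expn_gt0.
have [f fP] := choice (fun i => cover_cell (e_gt0 i) (Uk0 i)).
pose B i := (f i).1; pose j i := (f i).2.
have sum_le : (\sum_(i <oo) (cweight p s (j i))%:E <= M'%:E)%E.
  apply: le_trans (_ : \sum_(i <oo) ((p%:R `^ s)%:E * hausdorff_weight s (U i)
      + (1 / (2 ^ i.+1)%N%:R)%:E) <= _)%E.
    apply: lee_nneseries => [i _ _|i _]; last by have [] := fP i.
    by rewrite lee_fin ltW // cweight_gt0.
  apply: le_trans (epsilon_trick _ _ _) _ => //.
    by move=> i; rewrite mule_ge0 ?lee_fin ?powR_ge0 ?hausdorff_weight_ge0.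
  rewrite nneseriesZl; last by move=> i _; exact: hausdorff_weight_ge0.
  rewrite /M' EFinD EFinM leeD2r // lee_wpmul2l ?lee_fin ?powR_ge0 //.
  by apply: le_trans (ltW small) _; rewrite lee_fin ler_norm.
have [|X lX] := @initial_leaf R p m n s K p_pr K1 B j k0 (fun i => let: And3 a _ _ :=
  fP i in a).
  apply: le_lt_trans sum_le _; rewrite lte_fin.
  have c0 := cweight_gt0 p_pr s k0 : 0 < _.
  have -> : (p ^ (k0 * (m * n)))%N%:R = (cweight p (m *
    n)%:R k0)^-1 :> R by rewrite cweight_nat // invrK.
  have -> : cweight p (m * n)%:R k0 = cweight p s k0 * cweight p ((m * n)%:R - s) k0 :> R.
    by rewrite -cweightD // addrC subrK.
  have e1 := cweight_gt0 p_pr ((m * n)%:R - s) k0 : 0 < _.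
  set x := cweight p s k0 in c0 *; set y := cweight p _ k0 in e1 hk0 *.
  have -> : x / K * (x * y)^-1 = (K * y)^-1 by field; rewrite !gt_eqF.
  apply: lt_le_trans (_ : M' + 1 <= _); first by rewrite ltrDl.
  have M'1 : 0 < M' + 1 by rewrite addr_gt0.
  rewrite -[leLHS]invrK lef_pV2 ?posrE ?invr_gt0 ?mulr_gt0 //.
  rewrite -ler_pdivlMl //; move: hk0; by rewrite invfM.
have [Y WY nY] := escape B j _ _ lX.
have [i _ UiY] := WU Y WY.
by apply: (nY i); have [_ h _] := fP i; apply: h => //; exact: iW.
Qed.

End LowerBound.

(** * Vanishing Hausdorff measure *)

Section ContentBound.
Variables (R : realType) (T : metricType R).
Local Open Scope ereal_scope.

(** The double sequence is enumerated by a bijection between natural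
numbers and pairs of them. *)
Lemma hausdorff_content_double_cover (s delta : R) (E : set T) (V : nat -> nat -> set T) :
  E `<=` \bigcup_h \bigcup_k V h k ->
  (forall h k, diameter (V h k) <= delta%:E) ->
  hausdorff_content s delta E <=
  \sum_(h <oo) \sum_(k <oo) hausdorff_weight s (V h k).
Proof.
move=> EV Vd; have w0 h k : 0 <= hausdorff_weight s (V h k) by exact: hausdorff_weight_ge0.
have /card_esym/ppcard_eqP[f] := card_nat2.
apply: (@le_trans _ _ (\sum_(i <oo) hausdorff_weight s (V (f i).1 (f i).2))).
  apply: ereal_inf_lbound; exists (fun i => V (f i).1 (f i).2) => //; split=> // x Ex.
  have [h _ [k _ Vx]] := EV x Ex; exists (f^-1%FUN (h, k)) => //=.
  by rewrite invK ?inE.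
rewrite nneseries_esumT //.
rewrite -(@reindex_esum R _ _ setT setT f (fun hk => hausdorff_weight s (V hk.1 hk.2)));
  last exact: bij.
have -> : [set: nat * nat] = [set: nat] `*`` (fun=> [set: nat]) by apply/seteqP.
rewrite -(@esum_esum R _ _ [set: nat] (fun=> [set: nat]) (fun h k => hausdorff_weight s (V h k))) //.
rewrite -nneseries_esumT; last by move=> h; apply: esum_ge0.
rewrite le_eqVlt; apply/orP; left; apply/eqP/eq_eseriesr => h _.
by rewrite nneseries_esumT.
Qed.

Lemma nneseries_finite_support (u : nat -> \bar R) (N : nat) (c : R) : (0 <= c)%R ->
  (forall k, (k < N)%N -> u k <= c%:E) -> (forall k, (N <= k)%N -> u k = 0) ->
  (forall k, 0 <= u k) -> \sum_(k <oo) u k <= (N%:R * c)%:E.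
Proof.
move=> c0 uc u0 u_ge0; rewrite (nneseries_split 0 N); last by move=> k _.
rewrite add0n [X in _ + X]eseries0 ?adde0; last by move=> k Nk _; exact: u0.
apply: le_trans (_ : \sum_(0 <= k < N) c%:E <= _).
  by rewrite big_nat [leRHS]big_nat; apply: lee_sum => k /andP[_ kN]; exact: uc.
by rewrite sumEFin lee_fin sumr_const_nat subn0 mulr_natl.
Qed.

Lemma nneseries_geometric (q : R) : (0 <= q < 1)%R ->
  \sum_(h <oo) (q ^+ h)%:E <= ((1 - q)^-1)%:E.
Proof.
move=> /andP[q0 q1]; apply: lime_le.
  by apply: is_cvg_nneseries => h _ _; rewrite lee_fin exprn_ge0.
apply: nearW => M; rewrite sumEFin lee_fin -[leRHS]mul1r ler_pdivlMr ?subr_gt0 //.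
rewrite big_mkord mulrC -opprB mulNr -subrX1 opprB.
by rewrite gerBl exprn_ge0.
Qed.

End ContentBound.

Section UpperBound.
Variables (R : realType) (p m n : nat) (tau : 'I_n -> R).
Hypothesis p_pr : prime p.
Hypothesis m_gt0 : (0 < m)%N.
Hypothesis tau_gt1 : forall i, 1 < tau i.
Local Notation T := (padic_mx R p m n).
Local Notation resmx := (resmx p m n).
Variables (j : 'I_n) (t : R).
Hypothesis t_gt0 : 0 < t.
Let kappa := tau j * (t - (m * n)%:R) + \sum_i Num.min (tau j) (tau i) - (m + n)%:R.
Hypothesis kappa_gt0 : 0 < kappa.

(** Classes modulo p^(level j) only see the congruences up to that modulus. *)
Definition trunc_level h i := minn (level tau h j) (level tau h i).

(** Every class modulo p^(level j) that contains a point approximated by a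
vector of height between p^h and p^(h + 1) is among these. *)
Definition shell_cells h := [pred X :
  resmx (level tau h j) | has_short p h.+1 (trunc_level h) (reprmx X)].

Lemma level_big h i : 1 <= h%:R * (tau i - 1) -> (h.+1 < level tau h i)%N.
Proof.
move=> h1; rewrite -(ltr_nat R); apply: le_lt_trans (level_gt tau h i).
by rewrite -natr1; lra.
Qed.

Let C : R := (3 ^ (m + n).+1)%N%:R * p%:R `^ (`|(m * n)%:R - t| + (m + n)%:R).

(** The count of [card_has_short] in the whole space, with t = h + 1. The
exponent obtained is - kappa h, up to a constant which absorbs the rounding in
[level]. *)
Lemma shell_weight h : (forall i, 1 <= h%:R * (tau i - 1)) ->
  #|shell_cells h|%:R * cweight p t (level tau h j) <= C * cweight p kappa h :> R.
Proof.
move=> h1; set l := level tau h j; pose g := trunc_level h.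
have tg i : (h.+1 + 0 < g i)%N.
  by rewrite addn0 /g /trunc_level leq_min !level_big.
have gl i : (g i <= l)%N by exact: geq_minl.
have hb : (h.+2 * p ^ (0 * (m + n)) <= p ^ h.+1)%N.
  by rewrite mul0n muln1 ltn_expl // prime_gt1.
have := card_has_short p_pr (0 : 'M[int]_(m, n)) m_gt0 (leq0n l) tg gl hb.
rewrite (eq_card (B := shell_cells h)); last by move=> X; rewrite !inE congmx0.
set N := #|_|%N; rewrite subn0 => hN.
have {hN} hN : N%:R * p%:R `^ (\sum_i g i)%:R <=
    (3 ^ (m + n).+1)%N%:R * p%:R `^ ((l * (m * n))%:R + (h.+1 * (m + n))%:R) :> R.
  by rewrite ppowD // -!ppow_nat // -!natrM ler_nat.
have gE : h%:R * \sum_i Num.min (tau j) (tau i) <= (\sum_i g i)%:R :> R.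
  rewrite natr_sum big_distrr; apply: ler_sum => i _ /=.
  rewrite /g /trunc_level natr_min minr_pMr ?ler0n //.
  rewrite le_min !ge_min !(ltW (level_gt tau h _)) ?orbT //.
have lE := level_le tau_gt1 h j.
have lE' := ltW (level_gt tau h j).
apply: le_trans (_ : (3 ^ (m + n).+1)%N%:R * p%:R `^ ((l * (m * n))%:R + (h.+1 * (m + n))%:R
   - (\sum_i g i)%:R) * cweight p t l <= _).
  rewrite ler_wpM2r ?(ltW (cweight_gt0 _ _ _)) //.
  rewrite ppowD // mulrA powRN ler_pdivlMr //.
  by rewrite powR_gt0 // ltr0n prime_gt0.
rewrite /C -!mulrA ler_wpM2l ?ler0n // /cweight -!ppowD //; apply: ppow_le => //.
have : l%:R * ((m * n)%:R - t) <= h%:R * tau j * ((m * n)%:R - t) + `|(m * n)%:R - t|.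
  rewrite -lerBlDl -mulrBl; apply: le_trans (_ : 1 * `|(m * n)%:R - t| <= _);
    last by rewrite mul1r.
  apply: le_trans (ler_norm _) _; rewrite normrM ler_wpM2r //.
  by rewrite ger0_norm /l; lra.
rewrite /kappa (natrM R l) (natrM R h.+1) -(natr1 h); move: gE.
set S := \sum_i _; set G := (\sum_i _)%:R; set a := (m * n)%:R; set b := (m + n)%:R.
set x := `|_|; nra.
Qed.

Local Notation level := (level tau).

(** The property defining the set, with an infinite supply of vectors
expressed by unbounded heights. *)
Definition approximable (X : T) := integral_mx X /\
  forall N, exists a, (N < int_height a)%N /\
    forall i, padic_abs R (padic_form a X i) < (int_height a)%:R `^ (- tau i).

Let tau_gt0 i : 0 < tau i. Proof. exact: lt_trans (tau_gt1 i). Qed.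

(** Let h be the integer part of log_p of the height of a. An integer matrix
close enough to X inherits the congruences modulo p^(level i), by the
ultrametric inequality and [padic_abs_int_lt]. *)
Lemma shell_cover (X : T) h0 : approximable X -> exists h Y,
  [/\ (h0 <= h)%N, Y \in shell_cells h & near_int (level h j) (reprmx Y) X].
Proof.
move=> [iX aX]; have [a [Ha aX']] := aX (p ^ h0)%N.
have H0 : (0 < int_height a)%N by apply: leq_ltn_trans Ha.
pose h := trunc_log p (int_height a).
have /andP[h1 h2] := trunc_log_bounds (prime_gt1 p_pr) H0.
have h0h : (h0 <= h)%N.
  by rewrite -ltnS -(ltn_exp2l _ _ (prime_gt1 p_pr)); exact: ltn_trans h2.
pose L := (\max_i level h i)%N.
have levL i : (level h i <= L)%N by exact: (@leq_bigmax _ (level h)).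
have [A hA] := near_int_exists p_pr L iX.
have aA : solves p (level h) a A.
  apply/solvesP => i; apply: (@padic_abs_int_lt R _ p_pr).
  set e := Num.truncn _.
  have e1 : (p ^ L)%N%:R^-1 < (p ^ e)%N%:R^-1 :> R.
    rewrite ltf_pV2 ?posrE ?ltr0n ?expn_gt0 ?prime_gt0 // ltr_nat ltn_exp2l ?prime_gt1 //.
    exact: levL.
  have e2 : padic_abs R (padic_form a X i) < (p ^ e)%N%:R^-1.
    apply: lt_le_trans (aX' i) _;
      rewrite powRN lef_pV2 ?posrE ?powR_gt0 ?ltr0n ?H0 ?(expp_gt0 p_pr) //.
    apply: le_trans (_ : (p ^ h)%N%:R `^ tau i <= _); last first.
      apply: ge0_ler_powR; rewrite ?nnegrE ?ler0n ?(ltW (tau_gt0 i)) //.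
      by rewrite ler_nat.
    rewrite !ppow_nat // -powRrM; apply: ppow_le => //.
    by have /andP[] := truncn_itv (mulr_ge0 (ler0n R h) (ltW (tau_gt0 i))).
  have emax : Num.max (padic_abs R (padic_form a X i)) (p ^ L)%N%:R^-1 < (p ^ e)%N%:R^-1.
    by rewrite gt_max e2 e1.
  apply: le_lt_trans emax.
    have -> : (zform a A 0 i)%:~R = padic_form a X i - (padic_form a X i - (zform a A 0 i)%:~R) :> Qp p by ring.
    apply: padic_abs_max; first by rewrite le_max lexx.
    by rewrite padic_absN le_max padic_form_zform // orbT.
pose l := level h j.
have Y_A : congmx p l (reprmx (redmx p l A)) A by exact: reprmx_redmx.
exists h, (redmx p l A); split=> //.
  apply/has_shortP; exists a; split.
  - apply: contraTneq H0 => ->; rewrite lt0n negbK; apply/eqP/eqP.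
    by rewrite -leqn0; apply/bigmax_leqP => c _; rewrite mxE.
  - by move=> c; apply: leq_trans (ltnW h2); exact: (@leq_bigmax _ (fun c => `|a 0%R c|%N)).
  - rewrite (solves_congmx _ _ Y_A); last by move=> i; exact: geq_minl.
    by apply: solves_le aA => i; exact: geq_minr.
by apply: (congmx_near_int p_pr (near_int_le p_pr (levL j) hA)); rewrite congmx_sym.
Qed.

Definition cell l (Y : resmx l) : set T := [set X | near_int l (reprmx Y) X].

Lemma cell_diameter l (Y : resmx l) : (diameter (cell Y) <= ((p ^ l)%N%:R^-1)%:E)%E.
Proof.
apply: diameter_le => [|X X' hX hX']; first exact/ltW/pinv_gt0.
apply/(padic_mx_dist_ler X X' (ltW (pinv_gt0 R p_pr l))) => i i'.
have -> : X i i' - X' i i' = (X i i' - (reprmx Y i i')%:~R) - (X' i i' - (reprmx Y i i')%:~R) by ring.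
by apply: padic_abs_max; rewrite ?padic_absN; [exact: hX|exact: hX'].
Qed.

Lemma hausdorff_weight_le (U : set T) l : (diameter U <= ((p ^ l)%N%:R^-1)%:E)%E ->
  (hausdorff_weight t U <= (cweight p t l)%:E)%E.
Proof.
move=> Ul; rewrite /hausdorff_weight; case: ifP => _;
  first by rewrite lee_fin ltW // cweight_gt0.
have := diameter_ge0 U; case: (diameter U) Ul => [d dl d0|//|//].
rewrite poweR_EFin lee_fin cweight_powR //.
by apply: ge0_ler_powR; rewrite ?nnegrE ?(ltW t_gt0) ?(ltW (pinv_gt0 R p_pr _)).
Qed.

(** The cells of the shells h >= h0 cover the set, and the sum of their
weights is a geometric series of ratio p^(- kappa) which starts at h0. *)
Theorem hausdorff_measure_zero (E : set T) :
  (forall X, E X -> approximable X) -> hausdorff_measure t E = 0%E.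
Proof.
move=> Eapp.
have C0 : 0 < C by rewrite mulr_gt0 ?ltr0n ?expn_gt0 // powR_gt0 // ltr0n prime_gt0.
have q0 : 0 < cweight p kappa 1 :> R by exact: cweight_gt0.
have q1 : cweight p kappa 1 < 1 :> R.
  rewrite -(powRr0 p%:R) /cweight; apply: ppow_lt => //.
  by rewrite mul1r oppr_lt0.
have c_ge0 delta : (0 <= hausdorff_content t delta E)%E.
  apply: le_ereal_inf_tmp => _ [U _ <-].
  by apply: nneseries_ge0 => i _ _; exact: hausdorff_weight_ge0.
suff c_le0 delta : 0 < delta -> (hausdorff_content t delta E <= 0)%E.
  apply/eqP; rewrite eq_le; apply/andP; split.
    by apply: ge_ereal_sup => _ [delta d0 <-]; exact: c_le0.
  apply: le_trans (c_ge0 1) _; apply: ereal_sup_ubound; exists 1 => /=;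
    [exact: ltr01|by []].
move=> d0; apply/lee_addgt0Pr => e e0; rewrite add0e.
have [|q hq] := @cweight_small R p p_pr kappa (e * (1 - cweight p kappa 1) / C) kappa_gt0.
  by rewrite !mulr_gt0 ?invr_gt0 // subr_gt0.
have [N hN] := pinv_small p_pr d0.
pose h0 := (q + N + \sum_i (Num.truncn (tau i - 1)^-1).+1)%N.
have h_ok h i : 1 <= (h0 + h)%N%:R * (tau i - 1).
  rewrite -ler_pdivrMr ?subr_gt0 // div1r; apply: ltW.
  apply: lt_le_trans (truncnS_gt _) _; rewrite ler_nat.
  apply: leq_trans (leq_addr h h0); apply: leq_trans (leq_addl _ _).
  by rewrite (bigD1 i) //= leq_addr.
pose V h k : set T := [set X | exists Y, [/\ Y \in shell_cells (h0 + h),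
  index Y (enum (shell_cells (h0 + h))) = k & cell Y X]].
have Vd h k : (diameter (V h k) <= ((p ^ level (h0 + h) j)%N%:R^-1)%:E)%E.
  apply: diameter_le => [|X X' [Y [Yc Yk YX]] [Y' [Y'c Y'k Y'X']]];
    first exact/ltW/pinv_gt0.
  have YY : Y' = Y.
    by rewrite -(nth_index Y (s := enum (shell_cells (h0 + h))) (x := Y')) ?mem_enum //
      Y'k -Yk nth_index ?mem_enum.
  rewrite YY in Y'X'; rewrite -lee_fin.
  exact: le_trans (mdist_le_diameter YX Y'X') (cell_diameter Y).
have Vw h k := hausdorff_weight_le (Vd h k).
apply: le_trans (@hausdorff_content_double_cover R T t delta E V _ _) _.
- move=> X EX; have [h [Y [h0h Yc hY]]] := shell_cover h0 (Eapp X EX).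
  exists (h - h0)%N => //; exists (index Y (enum (shell_cells h))) => //.
  by rewrite /V /= subnKC //; exists Y.
- move=> h k; apply: le_trans (Vd h k) _; rewrite lee_fin; apply: le_trans (ltW hN).
  apply: pinv_le => //; apply: leq_trans (_ : h0 + h <= _)%N;
    first by rewrite /h0 -!addnA addnCA leq_addr.
  rewrite -(ler_nat R); apply: le_trans (ltW (level_gt tau _ j)).
  by rewrite ler_peMr ?ler0n // ltW.
apply: le_trans (_ : \sum_(h <oo) (C * cweight p kappa h0)%:E *
  (cweight p kappa 1 ^+ h)%:E <= _)%E.
  apply: lee_nneseries => [h _ _|h _].
    by apply: nneseries_ge0 => k _ _; exact: hausdorff_weight_ge0.
  apply: le_trans (_ : (#|shell_cells (h0 + h)|%:R *
    cweight p t (level (h0 + h) j))%:E <= _)%E.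
    apply: nneseries_finite_support => [|k _|k kN|k].
    + exact/ltW/cweight_gt0.
    + exact: Vw.
    + rewrite /hausdorff_weight; case: ifP => // /negP; case.
      apply/eqP; rewrite -subset0 => X [Y [Yc Yk _]].
      by move: kN; rewrite -Yk cardE leqNgt index_mem mem_enum Yc.
    + exact: hausdorff_weight_ge0.
  rewrite -EFinM lee_fin; apply: le_trans (shell_weight (h_ok h)) _.
  by rewrite cweight_add // (cweightX p_pr kappa h) mulrA.
rewrite nneseriesZl; last by move=> h _; rewrite lee_fin exprn_ge0 // ltW.
apply: le_trans (lee_wpmul2l _ (nneseries_geometric _)) _.
- by rewrite lee_fin mulr_ge0 // ltW // cweight_gt0.
- by rewrite ltW.
rewrite -EFinM lee_fin ler_pdivrMr ?subr_gt0 //.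
rewrite mulrC -ler_pdivlMr //; apply: le_trans hq; apply: cweight_le => //;
  first exact: ltW.
by rewrite /h0 -addnA leq_addr.
Qed.

End UpperBound.

(** * The critical exponent and the dimension *)

Section Exponent.
Variables (R : realType) (n : nat) (tau : 'I_n -> R) (M d s : R).
Hypothesis tau_gt0 : forall i, 0 < tau i.
Hypothesis M_gt0 : 0 < M.
Hypothesis s_lt : s < d.
Hypothesis s_le : forall j, \sum_i Num.min (tau j) (tau i) - M <= tau j * (d - s).

(** Between two consecutive breakpoints tau_j the function sum_i min (x,
tau_i) is affine, with slope c the number of tau_i above x. If c is at least d
- s, the inequality at x follows from the one at the breakpoint on the right,
which exists because c > 0; otherwise from the one at the breakpoint on the
left, or at 0 if there is none. *)
Lemma min_sum_bound x : 0 < x -> \sum_i Num.min x (tau i) - M <= x * (d - s).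
Proof.
move=> x0; pose c : R := \sum_(i | x < tau i) 1.
have minE y i : (x < tau i -> y <= tau i) -> (tau i <= x -> tau i <= y) ->
    Num.min y (tau i) = Num.min x (tau i) + (y - x) * (if x < tau i then 1 else 0).
  move=> h1 h2; case: ltP => [xi|xi].
    by rewrite !min_l ?h1 ?ltW // mulr1 addrC subrK.
  by rewrite !min_r ?h2 // mulr0 addr0.
have sumE y : (forall i, x < tau i -> y <= tau i) -> (forall i, tau i <= x -> tau i <= y) ->
    \sum_i Num.min y (tau i) = \sum_i Num.min x (tau i) + (y - x) * c.
  move=> h1 h2; rewrite /c [X in _ * X]big_mkcond big_distrr -big_split /=.
  by apply: eq_bigr => i _; apply: minE; [exact: h1|exact: h2].
have [dc|cd] := leP (d - s) c.
  have [i0 xi0] : exists i, x < tau i.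
    apply: contrapT => nex; have c0 : c = 0.
      by rewrite /c big_pred0 // => i; apply/negP => xi; apply: nex; exists i.
    by have := s_lt; rewrite -subr_gt0 => /lt_le_trans/(_ dc); rewrite c0 ltxx.
  case: (@arg_minP _ _ _ i0 (fun i => x < tau i) tau xi0) => j xj jmin.
  have := s_le j; rewrite (sumE (tau j)) //; last first.
    by move=> i ix; exact: le_trans ix (ltW xj).
  have : (tau j - x) * (d - s) <= (tau j - x) * c by rewrite ler_wpM2l // subr_ge0 ltW.
  by lra.
have [[i0 xi0]|nex] := pselect (exists i, tau i <= x).
  case: (@arg_maxP _ _ _ i0 (fun i => tau i <= x) tau xi0) => j xj jmax.
  have := s_le j; rewrite (sumE (tau j)) //; last first.
    by move=> i ix; exact: le_trans xj (ltW ix).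
  have : (x - tau j) * c <= (x - tau j) * (d - s) by rewrite ler_wpM2l ?subr_ge0 // ltW.
  by lra.
have all i : x < tau i by rewrite ltNge; apply/negP => ix; apply: nex; exists i.
have -> : \sum_i Num.min x (tau i) = x * c.
  rewrite /c [in RHS](eq_bigl xpredT) // big_distrr /=; apply: eq_bigr => i _.
  by rewrite min_l ?mulr1 // ltW.
have : x * c <= x * (d - s) by rewrite ler_wpM2l // ltW.
by have := M_gt0; lra.
Qed.

End Exponent.

Section Dimension.
Variables (R : realType) (T : metricType R).
Local Open Scope ereal_scope.

Lemma hausdorff_content_anti (s : R) (E : set T) (delta delta' : R) :
  (delta <= delta')%R -> hausdorff_content s delta' E <= hausdorff_content s delta E.
Proof.
move=> dd; apply: ereal_inf_le_tmp => _ [U [EU Ud] <-]; exists U => //; split=> // i.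
by apply: le_trans (Ud i) _; rewrite lee_fin.
Qed.

Lemma hausdorff_weight_anti (s t : R) (U : set T) : (0 <= t <= s)%R ->
  diameter U <= 1 -> hausdorff_weight s U <= hausdorff_weight t U.
Proof.
move=> /andP[t0 ts]; rewrite /hausdorff_weight; case: ifP => // _.
have := diameter_ge0 U; case: (diameter U) => [d|//|//]; rewrite !lee_fin => d0 d1.
move: d0; rewrite le_eqVlt => /predU1P[<-|d0].
  have [s0|s0] := eqVneq s 0%R; last by rewrite powR0 ?powR_ge0.
  by rewrite (_ : t = s) //; apply/eqP; rewrite eq_le ts s0 t0.
by apply: ger_powR; rewrite ?d0.
Qed.

(** For sets of diameter at most 1 the weight decreases with the exponent, and
the restriction to covers by such sets only increases the content. *)
Lemma hausdorff_measure_anti (s t : R) (E : set T) : (0 <= t <= s)%R ->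
  hausdorff_measure s E <= hausdorff_measure t E.
Proof.
move=> ts; apply: ge_ereal_sup => _ [delta d0 <-].
pose e := Num.min delta 1%R.
have e0 : (0 < e)%R by rewrite lt_min d0 ltr01.
apply: le_trans (_ : hausdorff_content t e E <= _); last first.
  by apply: ereal_sup_ubound; exists e.
apply: le_trans (hausdorff_content_anti s E (_ : (e <= delta)%R)) _.
  by rewrite ge_min lexx.
apply: le_ereal_inf_tmp => _ [U [EU Ud] <-].
apply: le_trans (_ : \sum_(i <oo) hausdorff_weight s (U i) <= _).
  by apply: ereal_inf_lbound; exists U.
apply: lee_nneseries => [i _ _|i _]; first exact: hausdorff_weight_ge0.
apply: hausdorff_weight_anti => //; apply: le_trans (Ud i) _.
by rewrite lee_fin ge_min lexx orbT.
Qed.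

Lemma hausdorff_dimE (s : R) (E : set T) : (0 <= s)%R ->
  hausdorff_measure s E = +oo -> (forall t, (s < t)%R -> hausdorff_measure t E = 0) ->
  hausdorff_dim E = s%:E.
Proof.
move=> s0 Es Et; apply/eqP; rewrite eq_le; apply/andP; split.
  apply/lee_addgt0Pr => e e0; apply: ereal_inf_lbound; exists (s + e)%R => //; split.
    by rewrite addr_ge0 // ltW.
  by apply: Et; rewrite ltrDl.
apply: le_ereal_inf_tmp => _ [t [t0 tE] <-]; rewrite lee_fin leNgt; apply/negP => ts.
have : hausdorff_measure s E <= hausdorff_measure t E.
  by apply: hausdorff_measure_anti; rewrite t0 ltW.
by rewrite Es tE.
Qed.

End Dimension.

Section WellApproximable.
Variables (R : realType) (p m n : nat) (tau : 'I_n -> R).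
Hypothesis tau_gt0 : forall i, 0 < tau i.

(** There are finitely many integer vectors of bounded height, so a set of
them is infinite exactly when heights in it are unbounded. *)
Lemma well_approxE : padic_well_approx (power_psi tau) =
  [set X : padic_mx R p m n | approximable tau X].
Proof.
apply/seteqP; split=> X [iX hX]; split=> //.
  move=> N; apply: contrapT => nex; apply: hX.
  apply: (@sub_finite_set _ _ [set boxZ x | x in [set: box m n N]]); last first.
    by apply: finite_image; exact: finite_finset.
  move=> a /= aX; have [|x xa] := @boxZ_surj m n N a; last by exists x.
  move=> c; apply: leq_trans (@leq_bigmax _ (fun c => `|a 0%R c|%N) c) _.
  by rewrite leqNgt; apply/negP => Na; apply: nex; exists a.
move=> /finite_seqP[l lE].
have [a [aN aX]] := hX (\max_(b <- l) int_height b)%N.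
have al : a \in l.
  by have : [set` l] a by rewrite -lE.
by move: aN; rewrite ltnNge (leq_bigmax_seq _ al).
Qed.

End WellApproximable.

Theorem theorem8 (R : realType) (p n m : nat) (p_prime : prime p)
    (n_gt0 : (0 < n)%N) (m_gt0 : (0 < m)%N) (tau : 'I_n -> R)
    (tau_gt0 : forall i, 0 < tau i)
    (tau_sum : (m + n)%:R < \sum_(i < n) tau i)
    (tau_gt1 : forall i, 1 < tau i) :
  let W : set (padic_mx R p m n) := padic_well_approx (power_psi tau) in
  let f (j : 'I_n) : R :=
    n%:R * (m%:R - 1)
    + ((n + m)%:R - \sum_(i < n | tau i < tau j) (tau i - tau j)) / tau j in
  let s : R := \big[Num.min/f (Ordinal n_gt0)]_(j < n) f j in
  hausdorff_dim W = s%:E /\ hausdorff_measure s W = +oo%E.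
Proof.
move=> W f s.
(* In this form f j is the exponent at which kappa vanishes, and s <= f j is
the hypothesis of [min_sum_bound]. *)
have fE j : f j = (m * n)%:R + ((m + n)%:R - \sum_i Num.min (tau j) (tau i)) / tau j.
  have -> : \sum_i Num.min (tau j) (tau i) =
      n%:R * tau j + \sum_(i < n | tau i < tau j) (tau i - tau j).
    rewrite [in RHS]big_mkcond /= -[n in n%:R]card_ord mulr_natl -sumr_const -big_split.
    by apply: eq_bigr => i _ /=; case: ltP => _; rewrite ?addr0 // addrC subrK.
  by rewrite /f natrM !natrD; field; rewrite gt_eqF.
have s_le j : s <= f j by exact: bigmin_le.
have [j0 sE] : exists j, s = f j.
  case: (@arg_minP _ _ _ (Ordinal n_gt0) xpredT f isT) => j _ jmin; exists j.
  by apply/eqP; rewrite eq_le s_le /s le_bigmin //; exact: jmin.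
have s_gt0 : 0 < s.
  rewrite sE /f ltr_wpDl ?mulr_ge0 ?subr_ge0 ?ler1n // divr_gt0 // subr_gt0.
  apply: le_lt_trans (_ : 0 < _); last by rewrite ltr0n addn_gt0 n_gt0.
  by apply: sumr_le0 => i /ltW; rewrite subr_le0.
have s_lt : s < (m * n)%:R.
  case: (@arg_maxP _ _ _ (Ordinal n_gt0) xpredT tau isT) => j _ jmax.
  apply: le_lt_trans (s_le j) _; rewrite fE gtrDl pmulr_llt0 ?invr_gt0 // subr_lt0.
  suff -> : \sum_i Num.min (tau j) (tau i) = \sum_i tau i by [].
  by apply: eq_bigr => i _; rewrite min_r //; exact: jmax.
have s_opt : forall x, 0 < x ->
    \sum_(i < n) Num.min x (tau i) - (m + n)%:R <= x * ((m * n)%:R - s).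
  apply: min_sum_bound => //; first by rewrite ltr0n addn_gt0 m_gt0.
  move=> j; have := s_le j; rewrite fE -lerBlDl ler_pdivlMr // => h.
  by move: h; set u := \sum_i _; lra.
have [K K1 loc] := local_measure p_prime m_gt0 n_gt0 tau_gt1 tau_sum s_lt s_opt.
have Ws : hausdorff_measure s W = +oo%E.
  apply: (hausdorff_measure_infinite p_prime K1 s_gt0 s_lt).
    by move=> X; rewrite /W well_approxE => -[].
  move=> B j A0 k0 l0.
  have [X [iX nX aX]] := uncovered_point p_prime K1 loc l0.
  by exists X => //; rewrite /W well_approxE.
split=> //; apply: hausdorff_dimE => //; first exact: ltW.
move=> t st; apply: (hausdorff_measure_zero p_prime m_gt0 tau_gt1 (j := j0)).
- exact: lt_trans st.
- move: st; rewrite sE fE -ltrBrDl ltr_pdivrMr // => h; lra.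
- by move=> X; rewrite /W well_approxE.
Qed.
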